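(* Let $u\in\mathbb{K}$ be the minimizer of $J(v)=\frac12\int_\Omega|\nabla v|^2\,dx$ over $\mathbb{K}$. Let $q^*\in H(\Omega_\pm,\mathrm{div})$ and $\lambda\in\Lambda$ satisfy $$\int_{\Omega_+}\mathrm{div}\,q^*\,dx=\int_{\Omega_-}\mathrm{div}\,q^*\,dx=0\qquad\text{and}\qquad\int_{\mathcal{M}}(\lambda-[q^*\cdot\mathbf{n}])\,d\mu=0 .$$ Then for every $v\in\mathbb{K}$ and every $\alpha\in[0,1]$, $$\begin{aligned}\|\nabla(v-u)\|_\Omega\le{}&\|\nabla v-q^*\|_\Omega+\sqrt2\Big(\int_{\mathcal{M}}\lambda(v-\psi)\,d\mu\Big)^{1/2}\\&+\Big((\mathfrak{D}_-(q^* )+\alpha\,\mathfrak{m}_-(q^* ))^2+(\mathfrak{D}_+(q^* )+(1-\alpha)\,\mathfrak{m}_+(q^* ))^2\Big)^{1/2},\end{aligned}$$ where $\mathfrak{D}_\pm(q^* )=C_{P_{\Omega_\pm}}\|\mathrm{div}\,q^*\|_{\Omega_\pm}$ and $\mathfrak{m}_\pm(q^* )=C_{P_{\mathcal{M}}}(\Omega_\pm)\|\lambda-[q^*\cdot\mathbf{n}]\|_{\mathcal{M}}$.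
   Context: $\Omega\subset\mathbb{R}^n$ is open, connected and bounded with Lipschitz continuous boundary $\partial\Omega$; $\mathcal{M}$ is a smooth $(n-1)$-dimensional manifold in $\mathbb{R}^n$ which divides $\Omega$ into two Lipschitz subdomains $\Omega_+$ and $\Omega_-$. Integrals over $\mathcal{M}$ (with surface measure $d\mu$) and the space $L^2(\mathcal{M})$ refer to the part of $\mathcal{M}$ in $\Omega$; values of Sobolev functions on $\mathcal{M}$ and $\partial\Omega$ are traces. $\|\cdot\|_\omega$ denotes the $L^2(\omega)$ norm of scalar or vector-valued functions. The obstacle $\psi:\mathcal{M}\to\mathbb{R}$ is smooth, the boundary datum is $\varphi\in H^{1/2}(\partial\Omega)$, and $\varphi\ge\psi$ on $\mathcal{M}\cap\partial\Omega$. Admissible set: $\mathbb{K}=\{v\in H^1(\Omega): v\ge\psi\text{ on }\mathcal{M}\cap\Omega,\ v=\varphi\text{ on }\partial\Omega\}$; it is known that $J$ has a unique minimizer $u$ over $\mathbb{K}$ (the thin obstacle problem). $\Lambda=\{\lambda\in L^2(\mathcal{M}):\lambda\ge0\text{ a.e. on }\mathcal{M}\}$. $H(\Omega_\pm,\mathrm{div})=\{q^*\in L^2(\Omega,\mathbb{R}^n):\mathrm{div}(q^*|_{\Omega_\pm})\in L^2(\Omega_\pm)\text{ (for both signs)},\ [q^*\cdot\mathbf{n}]\in L^2(\mathcal{M})\}$, where $[q^*\cdot\mathbf{n}]=q^*|_{\Omega_+}\cdot\mathbf{n}_++q^*|_{\Omega_-}\cdot\mathbf{n}_-$ is the jump of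 the normal component across $\mathcal{M}$, $\mathbf{n}_\pm$ being the outer unit normals to $\Omega_\pm$ on $\mathcal{M}$ (understood in the generalized sense, via integration by parts against $w\in H^1_0(\Omega)$); $\mathrm{div}\,q^*$ on $\Omega_\pm$ means $\mathrm{div}(q^*|_{\Omega_\pm})$. Constants: $C_{P_{\Omega_\pm}}$ are constants in the Poincaré inequalities $\|w\|_{\Omega_\pm}\le C_{P_{\Omega_\pm}}\|\nabla w\|_{\Omega_\pm}$ for all $w\in H^1(\Omega_\pm)$ with zero mean value over $\Omega_\pm$; $C_{P_{\mathcal{M}}}(\Omega_\pm)$ are constants in the inequalities $\|w\|_{\mathcal{M}}\le C_{P_{\mathcal{M}}}(\Omega_\pm)\|\nabla w\|_{\Omega_\pm}$ for all $w\in H^1(\Omega_\pm)$ whose trace on $\mathcal{M}$ has zero mean value over $\mathcal{M}$. *)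

(* Defs.v *)
From HB Require Import structures.
From mathcomp Require Import all_boot all_order all_algebra.
From mathcomp Require Import all_classical all_reals all_analysis.
Import Order.TTheory GRing.Theory Num.Theory.
Import numFieldNormedType.Exports.

Set Implicit Arguments.
Unset Strict Implicit.
Unset Printing Implicit Defensive.

Local Open Scope classical_set_scope.
Local Open Scope ring_scope.

(* Outer measure generated by the countable covers of a set, each covering set
   A being charged g A (infinite if A may not be used). *)
Section cover_outer.
Context {R : realType} {T : pointedType}.
Local Open Scope ereal_scope.

Definition cover_outer (g : set T -> \bar R) (X : set T) : \bar R :=
  ereal_inf [set \sum_(k <oo) g (F k)
            | F in [set F : (set T)^nat | X `<=` \bigcup_k F k]].

Let D := g_sigma_algebraType [set: set T].

Lemma cover_outerE (g : set T -> \bar R) :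
  cover_outer g = @mu_ext _ D R g.
Proof.
apply/funext => X; rewrite /cover_outer /mu_ext /measurable_cover.
congr (ereal_inf [set _ | _ in _]); apply/seteqP; split => [F XF|F []//].
by split => // i; exact: sub_sigma_algebra.
Qed.

Variable g : set T -> \bar R.
Hypotheses (g0 : g set0 = 0) (g_ge0 : forall A, 0 <= g A).

Lemma cover_outer0 : cover_outer g set0 = 0.
Proof. by rewrite cover_outerE; exact: mu_ext0. Qed.

Lemma cover_outer_ge0 X : 0 <= cover_outer g X.
Proof. by rewrite cover_outerE; exact: mu_ext_ge0. Qed.

Lemma le_cover_outer : {homo cover_outer g : A B / A `<=` B >-> A <= B}.
Proof.
move=> A B AB; rewrite /cover_outer; apply/ereal_inf_le_tmp => _ [F BF <-].
by exists F => //; exact: subset_trans AB BF.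
Qed.

Lemma cover_outer_sigma_subadditive : sigma_subadditive (cover_outer g).
Proof. by rewrite cover_outerE; exact: (@mu_ext_sigma_subadditive _ D R g g_ge0). Qed.

End cover_outer.

Section euclid.
Context {R : realType}.

Definition dot {m} (x y : 'rV[R]_m) : R := \sum_i x 0 i * y 0 i.

(* The library norm on row vectors is the sup norm, hence this one. *)
Definition enorm {m} (x : 'rV[R]_m) : R := Num.sqrt (dot x x).

End euclid.

Section lebesgue.
Context {R : realType} {n : nat}.
Local Notation E := 'rV[R]_n.+1.
Local Open Scope ereal_scope.

Definition box (a b : E) : set E :=
  [set x | forall i, (a 0 i < x 0 i <= b 0 i)%R].

Definition box_vol (A : set E) : \bar R :=
  ereal_inf [set (\prod_i (ab.2 0 i - ab.1 0 i))%R%:E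
            | ab in [set ab : E * E |
                     (forall i, (ab.1 0 i <= ab.2 0 i)%R) /\
                     A = box ab.1 ab.2]].

Lemma box_vol_ge0 A : 0 <= box_vol A.
Proof.
apply: le_ereal_inf_tmp => _ [ab [ab_le _] <-].
by rewrite lee_fin; apply: prodr_ge0 => i _; rewrite subr_ge0.
Qed.

Lemma box_vol0 : box_vol set0 = 0.
Proof.
apply/eqP; rewrite eq_le box_vol_ge0 andbT; apply: ereal_inf_lbound.
exists (0%R, 0%R) => /=.
  split=> //; apply/esym/seteqP; split=> // x /(_ ord0).
  by rewrite !mxE => /andP[/lt_le_trans h /h]; rewrite ltxx.
by rewrite big_ord_recl /= !mxE subrr mul0r.
Qed.

Definition lebesgue_outer : set E -> \bar R := cover_outer box_vol.

HB.instance Definition _ := isOuterMeasure.Build R E lebesgue_outer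
  (cover_outer0 box_vol0 box_vol_ge0) (cover_outer_ge0 box_vol_ge0)
  (@le_cover_outer _ _ box_vol)
  (cover_outer_sigma_subadditive box_vol_ge0).

End lebesgue.

Section hausdorff.
Context {R : realType} {n : nat} (d : nat).
Local Notation E := 'rV[R]_n.+1.

(* Volume pi^(k/2) / Gamma(k/2 + 1) of the unit ball of R^k, through the
   recurrence V_(k+2) = 2 pi / (k+2) * V_k. *)
Fixpoint unit_ball_vol (k : nat) : R :=
  match k with
  | 0 => 1
  | 1 => 2
  | (k'.+1 as k1).+1 => 2 * pi / (k1.+1)%:R * unit_ball_vol k'
  end.

Lemma unit_ball_vol_ge0 k : 0 <= unit_ball_vol k.
Proof.
suff: (0 <= unit_ball_vol k) && (0 <= unit_ball_vol k.+1) by case/andP.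
elim: k => [|k /andP[h1 h2]]; first by rewrite /= ler01 ler0n.
rewrite h2 andTb -/(unit_ball_vol k) /=; apply: mulr_ge0 => //.
by apply: divr_ge0 => //; apply: mulr_ge0 => //; exact: pi_ge0.
Qed.

Local Open Scope ereal_scope.

Definition ediam (A : set E) : \bar R :=
  ereal_sup [set (enorm (xy.1 - xy.2))%:E | xy in A `*` A].

Definition hausdorff_gauge (delta : R) (A : set E) : \bar R :=
  if A == set0 then 0
  else if ediam A <= delta%:E
  then (unit_ball_vol d * (fine (ediam A) / 2) ^+ d)%R%:E
  else +oo.

Lemma hausdorff_gauge0 delta : hausdorff_gauge delta set0 = 0.
Proof. by rewrite /hausdorff_gauge eqxx. Qed.

Lemma hausdorff_gauge_ge0 delta A : 0 <= hausdorff_gauge delta A.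
Proof.
rewrite /hausdorff_gauge; case: ifPn => // /set0P[x Ax]; case: ifP => // _.
rewrite lee_fin mulr_ge0 ?unit_ball_vol_ge0// exprn_ge0// divr_ge0//.
apply/fine_ge0/le_ereal_sup_tmp; exists (enorm (x - x))%:E; first by exists (x, x).
by rewrite lee_fin sqrtr_ge0.
Qed.

Definition hausdorff_outer (A : set E) : \bar R :=
  ereal_sup [set cover_outer (hausdorff_gauge delta) A
            | delta in [set delta : R | (0 < delta)%R]].

Lemma hausdorff_outer0 : hausdorff_outer set0 = 0.
Proof.
rewrite /hausdorff_outer (_ : image _ _ = [set 0]) ?ereal_sup1//.
apply/seteqP; split=> [_ [delta _ <-]|_ ->].
  exact: (cover_outer0 (hausdorff_gauge0 _) (hausdorff_gauge_ge0 _)).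
exists 1%R; first exact: ltr01.
exact: (cover_outer0 (hausdorff_gauge0 _) (hausdorff_gauge_ge0 _)).
Qed.

Lemma hausdorff_outer_ge0 A : 0 <= hausdorff_outer A.
Proof.
apply: le_ereal_sup_tmp; exists (cover_outer (hausdorff_gauge 1) A).
  by exists 1%R => //; exact: ltr01.
exact: cover_outer_ge0 (hausdorff_gauge_ge0 _) _.
Qed.

Lemma le_hausdorff_outer :
  {homo hausdorff_outer : A B / A `<=` B >-> A <= B}.
Proof.
move=> A B AB; apply: ge_ereal_sup => _ [delta delta0 <-].
apply: le_ereal_sup_tmp; exists (cover_outer (hausdorff_gauge delta) B).
  by exists delta.
exact: le_cover_outer.
Qed.

Lemma hausdorff_outer_sigma_subadditive : sigma_subadditive hausdorff_outer.
Proof.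
move=> F; apply: ge_ereal_sup => _ [delta delta0 <-].
apply: (le_trans (cover_outer_sigma_subadditive (hausdorff_gauge_ge0 _) F)).
apply: lee_nneseries => k _.
  by move=> _; exact: cover_outer_ge0 (hausdorff_gauge_ge0 _) _.
by apply: ereal_sup_ubound; exists delta.
Qed.

HB.instance Definition _ := isOuterMeasure.Build R E hausdorff_outer
  hausdorff_outer0 hausdorff_outer_ge0 le_hausdorff_outer
  hausdorff_outer_sigma_subadditive.

End hausdorff.

(* Lebesgue measure dx on R^(n+1) and surface measure, i.e. the n-dimensional
   Hausdorff measure normalised to agree with the n-dimensional area; both on
   their complete sigma-algebras of Caratheodory-measurable sets. *)
Section measures.
Context {R : realType} {n : nat}.
Local Notation E := 'rV[R]_n.+1.

Definition leb_outer : {outer_measure set E -> \bar R} := @lebesgue_outer R n.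

Definition surf_outer : {outer_measure set E -> \bar R} :=
  @hausdorff_outer R n n.

Definition leb : {measure set (caratheodory_type leb_outer) -> \bar R} :=
  leb_outer : set (caratheodory_type leb_outer) -> \bar R.

Definition surf : {measure set (caratheodory_type surf_outer) -> \bar R} :=
  surf_outer : set (caratheodory_type surf_outer) -> \bar R.

End measures.

Section L2.
Context {R : realType} {d : measure_display} {T : measurableType d}.
Variables (mu : {measure set T -> \bar R}) (D : set T).

Definition sqint (f : T -> R) : \bar R :=
  (\int[mu]_(x in D) ((f x) ^+ 2)%:E)%E.

Definition in_L2 (f : T -> R) : Prop :=
  measurable_fun D f /\ (sqint f < +oo)%E.

Definition normL2 (f : T -> R) : R := Num.sqrt (fine (sqint f)).

Definition in_L2v {m} (f : T -> 'rV[R]_m) : Prop :=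
  forall i, in_L2 (fun x => f x 0 i).

Definition normL2v {m} (f : T -> 'rV[R]_m) : R :=
  normL2 (fun x => enorm (f x)).

End L2.

Section calculus.
Context {R : realType} {n : nat}.
Local Notation E := 'rV[R]_n.+1.

Definition partial (i : 'I_n.+1) (f : E -> R) : E -> R :=
  'D_(delta_mx 0 i) f.

Definition partials (s : seq 'I_n.+1) (f : E -> R) : E -> R :=
  foldr partial f s.

Definition cgrad (f : E -> R) (x : E) : E := \row_i partial i f x.

(* C^oo on the open set U: all iterated partial derivatives exist and are
   continuous there *)
Definition smooth_on (U : set E) (f : E -> R) : Prop :=
  forall (s : seq 'I_n.+1) (x : E), U x ->
    {for x, continuous (partials s f)} /\
    (forall i, derivable (partials s f) x (delta_mx 0 i)).

Definition test_fun (U : set E) (f : E -> R) : Prop :=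
  smooth_on setT f /\
  exists K : set E, [/\ compact K, K `<=` U & forall x, ~ K x -> f x = 0].

End calculus.

Section geometry.
Context {R : realType} {n : nat}.
Local Notation E := 'rV[R]_n.+1.

Definition boundary (U : set E) : set E := closure U `\` U°.

(* After a rigid motion sending x0 to 0, U is near 0 the strict epigraph
   {y | gam (y_1, ..., y_n) < y_0} of a Lipschitz function gam. *)
Definition lipschitz_boundary (U : set E) : Prop :=
  forall x0, boundary U x0 ->
  exists (r : R) (Q : 'M[R]_n.+1) (gam : 'rV[R]_n -> R) (L : R),
    [/\ 0 < r,
        Q *m Q^T = 1%:M,
        (forall y z, `|gam y - gam z| <= L * enorm (y - z)) &
        forall x, enorm (x - x0) < r ->
          let y := (x - x0) *m Q in
          U x <-> gam (col' 0 y) < y 0 0].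

Record lipschitz_domain (U : set E) : Prop := LipschitzDomain {
  domain_open : open U;
  domain_connected : connected U;
  domain_bounded : bounded_set U;
  domain_nonempty : U !=set0;
  domain_lipschitz : lipschitz_boundary U }.

(* Embedded smooth hypersurface of R^(n+1): locally the zero set of a smooth
   function without critical points. *)
Definition smooth_hypersurface (M : set E) : Prop :=
  forall x0, M x0 -> exists (U : set E) (F : E -> R),
    [/\ open U, U x0, smooth_on U F,
        (forall x, U x -> cgrad F x != 0) &
        forall x, U x -> (M x <-> F x = 0)].

Definition smooth_on_hypersurface (M : set E) (f : E -> R) : Prop :=
  forall x0, M x0 -> exists (U : set E) (F : E -> R),
    [/\ open U, U x0, smooth_on U F & forall x, U x -> M x -> f x = F x].

Record divides (M Om Omp Omm : set E) : Prop := Divides {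
  divides_plus : lipschitz_domain Omp;
  divides_minus : lipschitz_domain Omm;
  divides_disjoint : Omp `&` Omm = set0;
  divides_cover : Om `\` M = Omp `|` Omm;
  divides_interface :
    M `&` Om `<=` boundary Omp `&` boundary Omm }.

End geometry.

Section sobolev.
Context {R : realType} {n : nat}.
Local Notation E := 'rV[R]_n.+1.

Definition weak_grad (U : set E) (w : E -> R) (G : E -> E) : Prop :=
  forall (f : E -> R) (i : 'I_n.+1), test_fun U f ->
    \int[leb]_(x in U) (w x * partial i f x) =
    - \int[leb]_(x in U) (G x 0 i * f x).

Definition weak_div (U : set E) (q : E -> E) (h : E -> R) : Prop :=
  forall f : E -> R, test_fun U f ->
    \int[leb]_(x in U) dot (q x) (cgrad f x) =
    - \int[leb]_(x in U) (h x * f x).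

(* An element of H^1(U) comes with its weak gradient, which is unique up to
   null sets. *)
Record H1 (U : set E) := MkH1 {
  H1_fun :> E -> R;
  grad : E -> E;
  H1_L2 : in_L2 leb U H1_fun;
  grad_L2 : in_L2v leb U grad;
  gradP : weak_grad U H1_fun grad }.

(* g is the trace of w on G (a subset of the boundary of U, or a hypersurface
   inside U): the graph of the trace operator is the closure, in
   H^1(U) x L^2(G), of the graph of the restriction f |-> f|_G of functions f
   smooth up to the boundary. *)
Definition is_trace (U G : set E) (w : H1 U) (g : E -> R) : Prop :=
  in_L2 surf G g /\
  exists f : nat -> E -> R,
    [/\ forall k, smooth_on setT (f k),
        sqint leb U (fun x => f k x - w x) @[k --> \oo] --> 0%E,
        sqint leb U (fun x => enorm (cgrad (f k) x - grad w x))
          @[k --> \oo] --> 0%E &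
        sqint surf G (fun x => f k x - g x) @[k --> \oo] --> 0%E].

Definition in_H10 (U : set E) (w : H1 U) : Prop :=
  is_trace (boundary U) w (fun=> 0).

(* Sobolev-Slobodeckij space H^(1/2) of the n-dimensional surface G, so that
   the exponent of the kernel is n + 2 * (1/2). *)
Definition in_Hhalf (G : set E) (f : E -> R) : Prop :=
  in_L2 surf G f /\
  (\int[surf]_(x in G) \int[surf]_(y in G)
     ((f x - f y) ^+ 2 / enorm (x - y) ^+ n.+1)%:E < +oo)%E.

(* If w has trace tw on M and vanishes on the boundary of Om, integrating by
   parts on both sides of M (with the outer normals to Omp and Omm) gives
   \int_Om q . grad w = - \int_Omp div q w - \int_Omm div q w + \int_M j tw
   with j the jump of the normal component of q. *)
Definition is_jump (M Om Omp Omm : set E) (q : E -> E) (h j : E -> R) : Prop :=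
  forall (w : H1 Om) (tw : E -> R), in_H10 w -> is_trace (M `&` Om) w tw ->
    \int[leb]_(x in Om) dot (q x) (grad w x) +
    \int[leb]_(x in Omp) (h x * w x) + \int[leb]_(x in Omm) (h x * w x) =
    \int[surf]_(x in M `&` Om) (j x * tw x).

(* As Omp and Omm are disjoint, one function dvg carries the divergences of
   both restrictions of the field. *)
Record Hdiv (M Om Omp Omm : set E) := MkHdiv {
  Hdiv_fun :> E -> E;
  dvg : E -> R;
  jump : E -> R;
  Hdiv_L2 : in_L2v leb Om Hdiv_fun;
  dvg_plus_L2 : in_L2 leb Omp dvg;
  dvg_minus_L2 : in_L2 leb Omm dvg;
  dvg_plusP : weak_div Omp Hdiv_fun dvg;
  dvg_minusP : weak_div Omm Hdiv_fun dvg;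
  jump_L2 : in_L2 surf (M `&` Om) jump;
  jumpP : is_jump M Om Omp Omm Hdiv_fun dvg jump }.

Definition poincare_const (U : set E) (C : R) : Prop :=
  forall w : H1 U, \int[leb]_(x in U) w x = 0 ->
    normL2 leb U w <= C * normL2v leb U (grad w).

Definition trace_poincare_const (G U : set E) (C : R) : Prop :=
  forall (w : H1 U) (tw : E -> R), is_trace G w tw ->
    \int[surf]_(x in G) tw x = 0 ->
    normL2 surf G tw <= C * normL2v leb U (grad w).

End sobolev.

Section thin_obstacle.
Context {R : realType} {n : nat}.
Local Notation E := 'rV[R]_n.+1.
Variables (M Om : set E).

Definition admissible (psi phi : E -> R) : set (H1 Om) :=
  [set v | (exists2 tv : E -> R, is_trace (M `&` Om) v tv &
              {ae surf, forall x, (M `&` Om) x -> psi x <= tv x}) /\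
           is_trace (boundary Om) v phi].

Definition energy (v : H1 Om) : R :=
  2^-1 * \int[leb]_(x in Om) (enorm (grad v x) ^+ 2).

Definition is_minimizer (K : set (H1 Om)) (u : H1 Om) : Prop :=
  K u /\ forall v, K v -> energy u <= energy v.

Definition multiplier (lam : E -> R) : Prop :=
  in_L2 surf (M `&` Om) lam /\
  {ae surf, forall x, (M `&` Om) x -> 0 <= lam x}.

End thin_obstacle.

(* Main.v *)
Require Import Defs.
From HB Require Import structures.
From mathcomp Require Import all_boot all_order all_algebra.
From mathcomp Require Import all_classical all_reals all_analysis.
From mathcomp Require Import measurable_realfun ring lra.
Import Order.TTheory GRing.Theory Num.Theory.
Import numFieldNormedType.Exports.

Local Open Scope classical_set_scope.
Local Open Scope ring_scope.
Set Implicit Arguments.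
Unset Strict Implicit.
Unset Printing Implicit Defensive.

(** Set w = v - u. Since the admissible set is convex, minimality of u gives
    int grad u . grad w >= 0, so that
      |grad w|^2 <= int grad v . grad w
                  = int (grad v - q) . grad w + int q . grad w.
    The first integral is at most |grad v - q| |grad w| by the Cauchy-Schwarz
    inequality. In the second one, w vanishes on the boundary, and the definition
    of the jump j of the normal component of q turns it into
      int_M j w - int_Omp div q w - int_Omm div q w.
    The divergence has zero mean on each subdomain, so w may be replaced there by w
    minus its mean, and the Poincare inequality bounds the two volume terms by D+ and
    D- times the norms of grad w over the subdomains (poincare_pairing). Next,
      int_M j w = int_M lam w - int_M (lam - j) w.
    As lam - j has zero mean on M, the last integral is bounded in the same way
    through the trace inequality (trace_poincare_pairing), from either side of M; a
    convex combination of the two bounds with weights alpha and 1 - alpha is used.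
    Finally lam >= 0 and u >= psi on M give int_M lam w <= int_M lam (v - psi) =: I.
    With N = |grad w|, A = |grad v - q| and B the last term of the estimate, this
    shows N^2 <= (A + B) N + I, whence N <= A + B + I^(1/2) (quadratic_le), which is
    slightly stronger than the claim.

    The argument needs several facts on the concrete measures.
    - Open sets are measurable (open_caratheodory): half-spaces split the boxes
      additively, and Hausdorff measure is additive on sets at positive distance,
      which yields half-spaces by Caratheodory's annuli argument.
    - The interface has finite measure, so that mean values over it exist
      (surf_boundary_finite): a Lipschitz boundary is compact and locally a
      Lipschitz graph, which is covered by N^n sets of diameter C / N.
    - Constants have weak gradient zero, so that means may be subtracted (H1_cst):
      partial derivatives of test functions have zero integral, by translation
      invariance and dominated convergence. *)

(** * Euclidean norm and elementary inequalities *)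

Section enorm_facts.
Context {R : realType}.

Lemma dotC m (x y : 'rV[R]_m) : dot x y = dot y x.
Proof. by apply: eq_bigr => i _; rewrite mulrC. Qed.

Lemma dot_ge0 m (x : 'rV[R]_m) : 0 <= dot x x.
Proof. by apply: sumr_ge0 => i _; exact: sqr_ge0. Qed.

Lemma enorm_ge0 m (x : 'rV[R]_m) : 0 <= enorm x.
Proof. exact: sqrtr_ge0. Qed.

Lemma sqr_enorm m (x : 'rV[R]_m) : enorm x ^+ 2 = dot x x.
Proof. by rewrite sqr_sqrtr // dot_ge0. Qed.

Lemma coord_le_enorm m (x : 'rV[R]_m) i : `|x 0 i| <= enorm x.
Proof.
rewrite -sqrtr_sqr; apply: ler_wsqrtr; rewrite /dot (bigD1 i)//= -expr2 lerDl.
by apply: sumr_ge0 => j _; exact: sqr_ge0.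
Qed.

Lemma enorm_le_sum m (x : 'rV[R]_m) : enorm x <= \sum_i `|x 0 i|.
Proof.
have s0 : 0 <= \sum_i `|x 0 i| by apply: sumr_ge0 => i _; exact: normr_ge0.
rewrite -(ger0_norm s0) -sqrtr_sqr; apply: ler_wsqrtr.
rewrite expr2 mulr_suml; apply: ler_sum => i _.
apply: (le_trans (ler_norm _)); rewrite normrM; apply: ler_wpM2l => //.
by rewrite (bigD1 i)//= lerDl; apply: sumr_ge0 => j _; exact: normr_ge0.
Qed.

End enorm_facts.

Section euclidean_norm.
Context {R : realType}.

(** The discriminant form of the Cauchy-Schwarz inequality. *)
Lemma discriminant_le (a b c : R) : 0 <= a -> 0 <= c ->
  (forall t, 0 <= a + 2 * t * b + t ^+ 2 * c) -> `|b| <= Num.sqrt a * Num.sqrt c.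
Proof.
move=> a0 c0 h; rewrite -sqrtrM// -sqrtr_sqr; apply: ler_wsqrtr.
have [c_eq0|c_neq0] := eqVneq c 0.
  have [->|b0] := eqVneq b 0; first by rewrite expr0n mulr_ge0.
  have := h (- (a + 1) / (2 * b)); rewrite c_eq0 mulr0 addr0.
  suff -> : a + 2 * (- (a + 1) / (2 * b)) * b = -1 by rewrite ler0N1.
  by field.
have := h (- b / c).
have -> : a + 2 * (- b / c) * b + (- b / c) ^+ 2 * c = (a * c - b ^+ 2) / c.
  by field.
by rewrite pmulr_lge0 ?invr_gt0 ?lt_def ?c_neq0// subr_ge0.
Qed.

Lemma dotDl m (x y z : 'rV[R]_m) : dot (x + y) z = dot x z + dot y z.
Proof. by rewrite -big_split; apply: eq_bigr => i _; rewrite mxE mulrDl. Qed.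

Lemma dotZl m a (x z : 'rV[R]_m) : dot (a *: x) z = a * dot x z.
Proof. by rewrite mulr_sumr; apply: eq_bigr => i _; rewrite mxE mulrA. Qed.

Lemma dotDr m (x y z : 'rV[R]_m) : dot z (x + y) = dot z x + dot z y.
Proof. by rewrite !(dotC z) dotDl. Qed.

Lemma dotZr m a (x z : 'rV[R]_m) : dot z (a *: x) = a * dot z x.
Proof. by rewrite !(dotC z) dotZl. Qed.

Lemma dotBr m (x y z : 'rV[R]_m) : dot z (x - y) = dot z x - dot z y.
Proof. by rewrite -scaleN1r dotDr dotZr mulN1r. Qed.

Lemma dotBl m (x y z : 'rV[R]_m) : dot (x - y) z = dot x z - dot y z.
Proof. by rewrite !(dotC _ z) dotBr. Qed.

Lemma dot_comb m (x y : 'rV[R]_m) t :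
  dot (x + t *: y) (x + t *: y) = dot x x + 2 * t * dot x y + t ^+ 2 * dot y y.
Proof. by rewrite !(dotDl, dotDr, dotZl, dotZr) (dotC y x); ring. Qed.

Lemma dot_le_enorm m (x y : 'rV[R]_m) : dot x y <= enorm x * enorm y.
Proof.
apply: le_trans (ler_norm _) _.
by apply: discriminant_le; rewrite ?dot_ge0// => t; rewrite -dot_comb dot_ge0.
Qed.

Lemma enormD m (x y : 'rV[R]_m) : enorm (x + y) <= enorm x + enorm y.
Proof.
rewrite -(ler_pXn2r (ltn0Sn 1)) ?nnegrE ?addr_ge0 ?enorm_ge0// sqr_enorm sqrrD.
rewrite !sqr_enorm dotDl !dotDr (dotC y x).
by have := dot_le_enorm x y; lra.
Qed.

Lemma enorm_mul_orth m (Q : 'M[R]_m) (x : 'rV[R]_m) :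
  Q *m Q^T = 1%:M -> enorm (x *m Q) = enorm x.
Proof.
move=> QQ; have dotE (z : 'rV[R]_m) : dot z z = (z *m z^T) 0 0.
  by rewrite mxE; apply: eq_bigr => i _; rewrite mxE.
by rewrite /enorm !dotE trmx_mul mulmxA -(mulmxA x) QQ mulmx1.
Qed.

Lemma enorm_col' m (x : 'rV[R]_m.+1) : enorm (col' 0 x) <= enorm x.
Proof.
apply: ler_wsqrtr; rewrite /dot [leRHS]big_ord_recl -expr2.
rewrite (eq_bigr (fun i : 'I_m => x 0 (lift ord0 i) * x 0 (lift ord0 i))).
  by rewrite lerDr sqr_ge0.
by move=> i _; rewrite !mxE.
Qed.

Lemma enorm_ball_nbhs m (x0 : 'rV[R]_m.+1) r : 0 < r ->
  nbhs x0 [set x | enorm (x - x0) < r].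
Proof.
move=> r0; apply/nbhs_ballP; exists (r / m.+1%:R) => /=; first by rewrite divr_gt0.
move=> x [_ x0x] /=; apply: (le_lt_trans (enorm_le_sum _)).
have -> : r = \sum_(i < m.+1) (r / m.+1%:R).
  by rewrite sumr_const card_ord -[RHS]mulr_natr divfK// pnatr_eq0.
apply: ltr_sum => [|i _]; first by apply/hasP; exists ord0; rewrite ?mem_index_enum.
by have := x0x 0 i; rewrite /ball /= !mxE distrC.
Qed.

Lemma enormZ m (a : R) (x : 'rV[R]_m) : enorm (a *: x) = `|a| * enorm x.
Proof. by rewrite /enorm dotZl dotZr mulrA -expr2 sqrtrM ?sqr_ge0// sqrtr_sqr. Qed.

End euclidean_norm.

Section real_lemmas.
Context {R : realType}.

Lemma pair_cauchy_schwarz (p q a b N : R) : 0 <= N -> a ^+ 2 + b ^+ 2 <= N ^+ 2 ->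
  p * a + q * b <= Num.sqrt (p ^+ 2 + q ^+ 2) * N.
Proof.
move=> N0 abN; have pq0 : 0 <= p ^+ 2 + q ^+ 2 by rewrite addr_ge0 ?sqr_ge0.
apply: (le_trans (ler_norm _)); rewrite -sqrtr_sqr -[N in leRHS](ger0_norm N0).
rewrite -sqrtr_sqr -sqrtrM//; apply: ler_wsqrtr.
apply: (@le_trans _ _ ((p ^+ 2 + q ^+ 2) * (a ^+ 2 + b ^+ 2))); last exact: ler_wpM2l.
by have := sqr_ge0 (p * b - q * a); nra.
Qed.

(** Stated for lower bounds, as they come out of bounds on absolute values. *)
Lemma convex_bound (t x a b : R) : 0 <= t <= 1 -> - a <= x -> - b <= x ->
  - x <= t * a + (1 - t) * b.
Proof.
move=> /andP[t0 t1] ax bx.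
have ta : t * - x <= t * a by apply: ler_wpM2l => //; rewrite lerNl.
have tb : (1 - t) * - x <= (1 - t) * b.
  by apply: ler_wpM2l; rewrite ?subr_ge0// lerNl.
lra.
Qed.

(** If N exceeded the bound, then N would exceed the square root s of r as well,
    whence N^2 > A N + s N >= A N + r. For negative r already N <= A. *)
Lemma quadratic_le (N A r : R) : 0 <= N -> 0 <= A -> N ^+ 2 <= A * N + r ->
  N <= A + r `^ 2^-1.
Proof.
move=> N0 A0 h; have [r0|r0] := leP 0 r.
  rewrite powR12_sqrt//; have := sqrtr_ge0 r; have := sqr_sqrtr r0.
  by move: (Num.sqrt r) => s; nra.
by have := powR_ge0 r 2^-1; nra.
Qed.

End real_lemmas.

(** * Half-spaces generate the measurability of open sets *)

Section halfspaces.
Context {R : realType} {n : nat}.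
Local Notation E := 'rV[R]_n.+1.
Implicit Types (mu : {outer_measure set E -> \bar R}).

Definition halfspace (i : 'I_n.+1) (c : R) : set E := [set x | x 0 i <= c].

Definition halfspaces_measurable mu :=
  forall i c, mu.-caratheodory (halfspace i c).

Lemma box_halfspaces (a b : E) :
  box a b = \big[setI/setT]_(i < n.+1)
              (halfspace i (b 0 i) `&` ~` halfspace i (a 0 i)).
Proof.
apply/seteqP; split => x.
  move=> xab; rewrite -bigcap_seq => i _; move/andP: (xab i) => [ax xb].
  by split => //=; apply/negP; rewrite -ltNge.
rewrite -bigcap_seq => h i; have [/= -> /negP] := h i (mem_index_enum i).
by rewrite -ltNge => ->.
Qed.

Lemma box_measurable mu (a b : E) : halfspaces_measurable mu ->
  (caratheodory_display mu).-measurable (box a b : set (caratheodory_type mu)).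
Proof.
move=> hmu; rewrite box_halfspaces.
apply: bigsetI_measurable => i _; apply: measurableI; first exact: hmu.
by apply: measurableC; exact: hmu.
Qed.

(** The countability that lets an arbitrary open set be reached from boxes. *)
Lemma open_rational_boxes (U : set E) : open U ->
  U = \bigcup_(k in [set ab : 'rV[rat]_n.+1 * 'rV[rat]_n.+1 |
                     box (map_mx ratr ab.1) (map_mx ratr ab.2) `<=` U])
        box (map_mx ratr k.1) (map_mx ratr k.2).
Proof.
move=> oU; apply/seteqP; split => [x Ux|x [k]]; last by move=> /[apply].
have /nbhs_ballP[e /= e0 xeU] : nbhs x U by apply: open_nbhs_nbhs; split.
have /choice[a ha] : forall i, exists q : rat, x 0 i - e / 2 < ratr q < x 0 i.
  move=> i; have [|q] := @rat_in_itvoo R (x 0 i - e / 2) (x 0 i); first lra.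
  by rewrite in_itv /= => ?; exists q.
have /choice[b hb] : forall i, exists q : rat, x 0 i < ratr q < x 0 i + e / 2.
  move=> i; have [|q] := @rat_in_itvoo R (x 0 i) (x 0 i + e / 2); first lra.
  by rewrite in_itv /= => ?; exists q.
exists (\row_i a i, \row_i b i) => /=; last first.
  move=> i; rewrite !mxE.
  by move: (ha i) (hb i) => /andP[_ ->] /andP[/ltW -> _].
move=> y xy; apply: xeU; split => // i j; rewrite ord1 /ball /= ltr_norml.
by move: (xy j) (ha j) (hb j); rewrite !mxE; lra.
Qed.

(** Both measures of the problem are Caratheodory restrictions of outer measures,
    so Borel measurability has to come from a splitting property. Half-spaces are
    the simplest sets to split along, and they suffice. *)
Lemma open_caratheodory mu (U : set E) : halfspaces_measurable mu -> open U ->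
  (caratheodory_display mu).-measurable (U : set (caratheodory_type mu)).
Proof.
move=> hmu oU; rewrite (open_rational_boxes oU) bigcup_mkcond.
apply: countable_bigcupT_measurable => [|k]; first exact: countableP.
by case: ifPn => // _; exact: box_measurable.
Qed.

End halfspaces.

(** * Lebesgue measure *)

Section cover_outer_facts.
Context {R : realType} {T : pointedType}.
Local Open Scope ereal_scope.
Implicit Types (g : set T -> \bar R).

(** Each covering set is cut along H1 and H2; if the charge does not grow under
    the cut, a cover of the union yields two covers of no larger total charge. *)
Lemma cover_outer_split g g1 g2 (H1 H2 A B : set T) :
  A `<=` H1 -> B `<=` H2 -> (forall F, 0 <= g1 F) ->
  (forall F, 0 <= g2 F) ->
  (forall F, g1 (F `&` H1) + g2 (F `&` H2) <= g F) ->
  cover_outer g1 A + cover_outer g2 B <= cover_outer g (A `|` B).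
Proof.
move=> AH1 BH2 g1_ge0 g2_ge0 gAB; apply: le_ereal_inf_tmp => _ [F ABF <-].
apply: (@le_trans _ _ (\sum_(k <oo) g1 (F k `&` H1) +
                       \sum_(k <oo) g2 (F k `&` H2))).
  apply: leeD; apply: ereal_inf_lbound.
  - exists (fun k => F k `&` H1) => // x Ax.
    by have [k _ Fkx] := ABF x (or_introl Ax); exists k => //; split=> //; exact: AH1.
  - exists (fun k => F k `&` H2) => // x Bx.
    by have [k _ Fkx] := ABF x (or_intror Bx); exists k => //; split=> //; exact: BH2.
rewrite -nneseriesD//; apply: lee_nneseries => k _ //.
by move=> _; exact: adde_ge0.
Qed.

Lemma cover_outer_le g (A : set T) : g set0 = 0 -> (forall F, 0 <= g F) ->
  cover_outer g A <= g A.
Proof.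
move=> g0 g_ge0; apply: ereal_inf_lbound; exists (fun k => if k is 0 then A else set0).
  by move=> x Ax; exists 0%N.
rewrite (nneseries_split _ 1)// ?add0n//.
rewrite big_mkord big_ord_recl big_ord0 adde0 eseries0 ?adde0// => -[|k]//.
Qed.

End cover_outer_facts.

Section lebesgue_halfspaces.
Context {R : realType} {n : nat}.
Local Notation E := 'rV[R]_n.+1.
Local Open Scope ereal_scope.

Lemma box_vol_le (a b : E) : (forall i, (a 0 i <= b 0 i)%R) ->
  box_vol (box a b) <= (\prod_i (b 0 i - a 0 i))%:E.
Proof. by move=> ab; apply: ereal_inf_lbound; exists (a, b). Qed.

Lemma prod_replace (i : 'I_n.+1) (f : 'I_n.+1 -> R) y :
  (\prod_j (if j == i then y else f j) = y * \prod_(j | j != i) f j)%R.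
Proof.
rewrite (bigD1 i)//= eqxx; congr (_ * _)%R.
by apply: eq_bigr => j /negbTE ->.
Qed.

(** The hyperplane, clamped to the box, cuts one edge into two, and the volume is
    linear in that edge. *)
Lemma box_vol_halfspace (i : 'I_n.+1) c (A : set E) :
  box_vol (A `&` halfspace i c) + box_vol (A `&` ~` halfspace i c) <= box_vol A.
Proof.
apply: le_ereal_inf_tmp => _ [[a b] /= [ab ->] <-].
pose m := Num.max (a 0 i)%R (Num.min c (b 0 i)%R).
have am : (a 0 i <= m)%R by rewrite le_max lexx.
have mb : (m <= b 0 i)%R by rewrite ge_max ab/= ge_min lexx orbT.
pose b' : E := (\row_j if j == i then m else b 0 j)%R.
pose a' : E := (\row_j if j == i then m else a 0 j)%R.
have -> : box a b `&` halfspace i c = box a b'.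
  apply/seteqP; split=> [x [xab xc] j|x xab].
    rewrite !mxE; move: (xab j); case: eqVneq => // -> /andP[ax xb].
    by rewrite ax/= /m le_max le_min xc xb orbT.
  split=> [j|].
    move: (xab j); rewrite !mxE; case: eqVneq => // -> /andP[->/=].
    by move=> /le_trans; apply.
  move: (xab i); rewrite !mxE eqxx /= /m le_max le_min.
  by case/andP => ax /orP[|/andP[]//]; rewrite leNgt ax.
have -> : box a b `&` ~` halfspace i c = box a' b.
  apply/seteqP; split=> [x [xab /negP]|x xab].
    rewrite -ltNge => cx j; rewrite !mxE.
    move: (xab j); case: eqVneq => // -> /andP[ax ->].
    by rewrite andbT /m gt_max ax/= gt_min cx.
  split=> [j|].
    move: (xab j); rewrite !mxE; case: eqVneq => // -> /andP[+ ->].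
    by rewrite andbT; apply: le_lt_trans.
  apply/negP; rewrite -ltNge.
  move: (xab i); rewrite !mxE eqxx /= /m gt_max gt_min.
  by move=> /andP[/andP[_ /orP[//|]]] /lt_le_trans h /h; rewrite ltxx.
have -> : (\prod_j (b 0 j - a 0 j) = \prod_j (b' 0 j - a 0 j) +
                                     \prod_j (b 0 j - a' 0 j))%R.
  rewrite [X in (X + _)%R](eq_bigr (fun j => if j == i then (m - a 0 i)%R
    else (b 0 j - a 0 j)%R)); last first.
    by move=> j _; rewrite !mxE; case: eqVneq => // ->.
  rewrite [X in (_ + X)%R](eq_bigr (fun j => if j == i then (b 0 i - m)%R
    else (b 0 j - a 0 j)%R)); last first.
    by move=> j _; rewrite !mxE; case: eqVneq => // ->.
  rewrite !prod_replace (bigD1 i)//= -mulrDl; congr (_ * _)%R; ring.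
rewrite EFinD; apply: leeD; apply: box_vol_le => j; rewrite !mxE;
  by case: eqVneq => // ->.
Qed.

Lemma lebesgue_halfspaces : halfspaces_measurable (@leb_outer R n).
Proof.
move=> i c; apply: le_caratheodory_measurable => X.
rewrite -[X in _ <= leb_outer X](setIT X) -(setUCr (halfspace i c)) setIUr.
by apply: (cover_outer_split _ _ box_vol_ge0 box_vol_ge0
  (box_vol_halfspace i c)) => x [].
Qed.

(** Constants are square integrable on bounded sets because of this bound. *)
Lemma leb_bounded (A : set E) : bounded_set A -> leb_outer A < +oo.
Proof.
move=> /pinfty_ex_gt0[r /= r0 Ar].
apply: (@le_lt_trans _ _ (leb_outer (box (\row_(i < n.+1) (- r - 1)%R) (\row_i r)))).
  apply: le_outer_measure => x /Ar.
  move=> xr i; rewrite !mxE.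
  have : (`|x 0%R i| <= r)%R.
    by apply: le_trans xr; rewrite [leRHS]mx_normrE; apply: (le_bigmax _ _ (0%R, i)).
  rewrite ler_norml; lra.
apply: (le_lt_trans (cover_outer_le _ box_vol0 box_vol_ge0)).
apply: (le_lt_trans (box_vol_le _)); last exact: ltry.
by move=> i; rewrite !mxE; lra.
Qed.

Lemma leb_open (U : set E) : open U ->
  (caratheodory_display leb_outer).-measurable (U : set (caratheodory_type (@leb_outer R n))).
Proof. exact/open_caratheodory/lebesgue_halfspaces. Qed.

End lebesgue_halfspaces.

(** * Hausdorff measure *)

Section hausdorff_halfspaces.
Context {R : realType} {n : nat} (d : nat).
Local Notation E := 'rV[R]_n.+1.
Local Open Scope ereal_scope.
Local Notation mu := (@hausdorff_outer R n d).

Lemma ediam_ge (A : set E) x y : A x -> A y -> (enorm (x - y))%:E <= ediam A.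
Proof. by move=> Ax Ay; apply: ereal_sup_ubound; exists (x, y). Qed.

Lemma ediam_ge0 (A : set E) : A !=set0 -> 0 <= ediam A.
Proof.
by move=> [x Ax]; apply: le_trans (ediam_ge Ax Ax); rewrite lee_fin enorm_ge0.
Qed.

Lemma le_ediam (A B : set E) : A `<=` B -> ediam A <= ediam B.
Proof.
by move=> AB; apply: ge_ereal_sup => _ [[x y] /= [Ax Ay] <-];
  apply: ediam_ge; exact: AB.
Qed.

Lemma le_hausdorff_gauge (delta delta' : R) (A B : set E) :
  (delta <= delta')%R -> A `<=` B ->
  hausdorff_gauge d delta' A <= hausdorff_gauge d delta B.
Proof.
move=> dd AB; have [->|A0] := eqVneq A set0.
  by rewrite hausdorff_gauge0 hausdorff_gauge_ge0.
have B0 : B != set0 by apply/set0P; apply: subset_nonempty AB _; exact/set0P.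
rewrite /hausdorff_gauge (negbTE A0) (negbTE B0).
have [Bd|_] := leP (ediam B) delta%:E; last by rewrite leey.
have AdB := le_ediam AB.
have /set0P/ediam_ge0 A_ge0 := A0.
rewrite (le_trans AdB) ?(le_trans Bd) ?lee_fin//.
apply: ler_wpM2l; first exact: unit_ball_vol_ge0.
apply: lerXn2r; rewrite ?nnegrE ?divr_ge0 ?fine_ge0 ?(le_trans A_ge0)//.
rewrite ler_pM2r ?invr_gt0// fine_le//.
  by rewrite ge0_fin_numE// (le_lt_trans AdB)// (le_lt_trans Bd) ?ltry.
by rewrite ge0_fin_numE ?(le_trans A_ge0)// (le_lt_trans Bd) ?ltry.
Qed.

(** A covering set of diameter at most the distance of two sets meets only one
    of them, so that it may be charged to that one alone. *)
Lemma hausdorff_gauge_separated (delta0 delta1 delta2 : R) (H1 H2 F : set E) :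
  (forall x y, H1 x -> H2 y -> (delta0 < enorm (x - y))%R) ->
  hausdorff_gauge d delta1 (F `&` H1) + hausdorff_gauge d delta2 (F `&` H2) <=
  hausdorff_gauge d (Num.min delta0 (Num.min delta1 delta2)) F.
Proof.
move=> sep; set m := Num.min _ _.
have [Fm|Fm] := leP (ediam F) m%:E; last first.
  rewrite [leRHS]/hausdorff_gauge ifN; last first.
    apply/eqP => F0; move: Fm; rewrite F0 ltNge => /negP; apply.
    by apply: ge_ereal_sup => z [[x y] [/= []]].
  by rewrite (leNgt (ediam F)) Fm leey.
have [->|/set0P[x [Fx Hx]]] := eqVneq (F `&` H1) set0.
  rewrite hausdorff_gauge0 add0e; apply: le_hausdorff_gauge => //.
  by rewrite /m !ge_min lexx !orbT.
have [->|/set0P[y [Fy Hy]]] := eqVneq (F `&` H2) set0.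
  rewrite hausdorff_gauge0 adde0; apply: le_hausdorff_gauge => //.
  by rewrite /m !ge_min lexx !orbT.
have := le_trans (ediam_ge Fx Fy) Fm; rewrite lee_fin /m le_min => /andP[+ _].
by rewrite leNgt sep.
Qed.

Lemma hausdorff_separated (delta0 : R) (H1 H2 A B : set E) : (0 < delta0)%R ->
  (forall x y, H1 x -> H2 y -> (delta0 < enorm (x - y))%R) ->
  A `<=` H1 -> B `<=` H2 -> mu A + mu B <= mu (A `|` B).
Proof.
move=> delta0_gt0 sep AH1 BH2.
have key delta1 delta2 : (0 < delta1)%R -> (0 < delta2)%R ->
    cover_outer (hausdorff_gauge d delta1) A +
    cover_outer (hausdorff_gauge d delta2) B <= mu (A `|` B).
  move=> d1 d2; apply: (@le_trans _ _ (cover_outer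
    (hausdorff_gauge d (Num.min delta0 (Num.min delta1 delta2))) (A `|` B))).
    apply: (cover_outer_split AH1 BH2) => F; [exact: hausdorff_gauge_ge0..|].
    exact: hausdorff_gauge_separated.
  apply: ereal_sup_ubound; exists (Num.min delta0 (Num.min delta1 delta2)) => //=.
  by rewrite !lt_min delta0_gt0 d1.
have [->|moo] := eqVneq (mu (A `|` B)) +oo; first by rewrite leey.
have fin X : X `<=` A `|` B -> mu X \is a fin_num.
  move=> XAB; rewrite ge0_fin_numE ?outer_measure_ge0//.
  by apply: (le_lt_trans (le_outer_measure mu _ _ XAB)); rewrite ltey.
rewrite addeC -leeBrDr ?fin//.
apply: ge_ereal_sup => _ [delta2 /= d2 <-].
rewrite leeBrDr ?fin// addeC -leeBrDr; last first.
  rewrite ge0_fin_numE ?cover_outer_ge0//; last exact: hausdorff_gauge_ge0.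
  apply: (@le_lt_trans _ _ (mu B)); first by apply: ereal_sup_ubound; exists delta2.
  by rewrite -ge0_fin_numE ?fin ?outer_measure_ge0.
apply: ge_ereal_sup => _ [delta1 /= d1 <-].
rewrite leeBrDr ?key//.
rewrite ge0_fin_numE ?cover_outer_ge0//; last exact: hausdorff_gauge_ge0.
apply: (@le_lt_trans _ _ (mu B)); first by apply: ereal_sup_ubound; exists delta2.
by rewrite -ge0_fin_numE ?fin ?outer_measure_ge0.
Qed.

(** A gap between two values of one coordinate is a gap in Euclidean distance. *)
Lemma hausdorff_separated_coord (i : 'I_n.+1) (s t : R) (A B : set E) :
  (s < t)%R -> (forall x, A x -> x 0%R i <= s)%R -> (forall x, B x -> t < x 0%R i)%R ->
  mu A + mu B <= mu (A `|` B).
Proof.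
move=> st As Bt.
apply: (@hausdorff_separated (t - s)%R [set x | x 0%R i <= s]%R [set x | t < x 0%R i]%R) => //.
  by rewrite subr_gt0.
move=> x y /= xs ty; apply: (@lt_le_trans _ _ `|(x - y)%R 0%R i|%R); last first.
  exact: coord_le_enorm.
by rewrite !mxE ltr_normr; apply/orP; right; lra.
Qed.

(** Caratheodory's annuli argument: the layers at distance about 1/k from the
    half-space have finite total measure, hence what lies beyond the k-th layer
    exhausts the complement of the half-space in measure. *)
Lemma hausdorff_halfspaces : halfspaces_measurable mu.
Proof.
move=> i c; apply: le_caratheodory_measurable => X.
change (mu (X `&` halfspace i c) + mu (X `&` ~` halfspace i c) <= mu X).
have [->|Xoo] := eqVneq (mu X) +oo; first by rewrite leey.
have Xfin : mu X < +oo by rewrite ltey.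
pose s k : R := (c + k.+1%:R^-1)%R.
have s_lt k : (s k.+1 < s k)%R by rewrite ltrD2l ltf_pV2 ?posrE// ltr_nat.
have c_lt k : (c < s k)%R by rewrite ltrDl invr_gt0.
pose b k := mu (X `&` [set x | s k < x 0%R i]%R).
pose L k := X `&` [set x | s k.+2 < x 0%R i <= s k.+1]%R.
pose r k := mu (L k).
have bX k : b k <= mu X by apply: le_outer_measure => x [].
have b_step k : b k + r k <= b k.+2.
  rewrite addeC.
  apply: (@le_trans _ _ (mu (L k `|` X `&` [set x | s k < x 0%R i]%R))).
    apply: (@hausdorff_separated_coord i (s k.+1) (s k)) => //.
    - by move=> x [_ /= /andP[]].
    - by move=> x [].
  apply: le_outer_measure => x [[Xx /andP[? ?]]|[Xx /= h]]; split => //=.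
  by rewrite (lt_trans _ h)// (lt_trans (s_lt _)).
(* A layer L k touches L k.+1 but not what lies beyond s k, so it is charged to
   the increase from b k to b k.+2; summed over k, these increases telescope. *)
have sumr N : \sum_(0 <= k < N) r k <= b N + b N.+1.
  elim: N => [|N IH].
    by rewrite big_geq// adde_ge0// outer_measure_ge0.
  rewrite big_nat_recr//=; apply: (le_trans (leeD IH (lexx _))).
  rewrite addeAC addeC; apply: leeD => //.
have r_ge0 k : 0 <= r k by exact: outer_measure_ge0.
have sumoo : \sum_(k <oo) r k < +oo.
  apply: (@le_lt_trans _ _ (mu X + mu X)); last by rewrite lte_add_pinfty.
  apply: lime_le; first by apply: is_cvg_nneseries => k _.
  by near=> N; apply: (le_trans (sumr N)); apply: leeD.
(* Beyond s m.+1 there is a gap to the half-space; the rest lies in layers past m. *)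
have main m : mu (X `&` halfspace i c) + mu (X `&` ~` halfspace i c) <=
    mu X + \sum_(m <= k <oo) r k.
  apply: (@le_trans _ _ (mu (X `&` halfspace i c) + (b m.+1 + \sum_(m <= k <oo) r k))).
    apply: leeD => //; apply: (@le_trans _ _ (b m.+1 + mu (\bigcup_(k in ~` `I_m) L k))).
      apply: le_trans (outer_measureU2 _ _ _); apply: le_outer_measure.
      move=> x [Xx /negP]; rewrite -ltNge => cx.
      have ex : exists k, (s k < x 0%R i)%R.
        exists (Num.truncn (x 0%R i - c)^-1)%R.
        rewrite /s -ltrBrDl invf_plt ?posrE ?subr_gt0//.
        exact: truncnS_gt.
      case: (ex_minnP ex) => k kx kmin; have [km|mk] := leqP k m.+1.
        left; split => //=; apply: le_lt_trans kx.
        by apply: lerD => //; rewrite lef_pV2 ?posrE// ler_nat.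
      right; case: k => [|[|k]]// in kx kmin mk *.
      exists k => /=; first by apply/negP; rewrite -leqNgt.
      split=> //=; rewrite kx /= leNgt; apply/negP => /kmin; by rewrite ltnn.
    by apply: leeD => //; exact: outer_measure_sigma_subadditive_tail.
  rewrite addeA; apply: leeD => //.
  apply: (@le_trans _ _ (mu (X `&` halfspace i c `|` X `&` [set x | s m.+1 < x 0%R i]%R))).
    by apply: (@hausdorff_separated_coord i c (s m.+1)) => // x [].
  by apply: le_outer_measure => x [[]|[]].
have tail : mu X + \sum_(m <= k <oo) r k @[m --> \oo] --> mu X + 0.
  apply: cvgeD; [by rewrite fin_num_adde_defl|exact: cvg_cst|].
  exact: nneseries_tail_cvg.
rewrite -[leRHS]adde0 -(cvg_lim _ tail)//; apply: lime_ge; first by apply/cvg_ex; eexists; exact: tail.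
by near=> m; exact: main.
Unshelve. all: by end_near. Qed.

End hausdorff_halfspaces.

Section surf_measurable.
Context {R : realType} {n : nat}.

Lemma surf_open (U : set 'rV[R]_n.+1) : open U ->
  (caratheodory_display surf_outer).-measurable (U : set (caratheodory_type (@surf_outer R n))).
Proof. exact/open_caratheodory/hausdorff_halfspaces. Qed.

End surf_measurable.

(** * Lipschitz boundaries have finite surface measure *)

Section compact_finite.
Context {R : realType} {T : topologicalType}.
Local Open Scope ereal_scope.

(** Otherwise the complements of the sets of finite measure would generate a
    proper filter, with a cluster point where the measure is not locally finite. *)
Lemma compact_outer_finite (mu : {outer_measure set T -> \bar R}) (A : set T) :
  compact A ->
  (forall x, A x -> exists2 V, nbhs x V & mu (A `&` V) < +oo) ->
  mu A < +oo.
Proof.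
move=> cA locfin; apply: contrapT => /negP; rewrite -leNgt leye_eq => /eqP Aoo.
pose F : set_system T := [set B | mu (A `&` ~` B) < +oo].
have FF : ProperFilter F.
  split; first by rewrite /F /= setC0 setIT Aoo.
  split.
  - by rewrite /F /= setCT setI0 outer_measure0.
  - move=> B C FB FC; rewrite /F /= setCI setIUr.
    by apply: (le_lt_trans (outer_measureU2 _ _ _)); exact: lte_add_pinfty.
  - move=> B C BC FB; apply: le_lt_trans FB; apply: le_outer_measure.
    by move=> x [Ax nC]; split => // /BC.
have [x [Ax clx]] := cA F FF ltac:(by rewrite /F /= setICr outer_measure0).
have [V Vx AV] := locfin x Ax.
have [z [nVz Vz]] : ~` V `&` V !=set0 by apply: clx => //; rewrite /F /= setCK.
exact: nVz Vz.
Qed.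

End compact_finite.

Section lipschitz_graph.
Context {R : realType} {n : nat}.
Local Notation E := 'rV[R]_n.+1.
Local Open Scope ereal_scope.

(** The charge of a finite cover, listed as a sequence padded with empty sets. *)
Lemma cover_outer_fin (T : pointedType) (g : set T -> \bar R) (I : finType)
    (A : I -> set T) (X : set T) : g set0 = 0 -> (forall F, 0 <= g F) ->
  X `<=` \bigcup_i A i -> cover_outer g X <= \sum_i g (A i).
Proof.
move=> g0 g_ge0 XA.
pose F k := if insub k : option 'I_#|I| is Some j then A (enum_val j) else set0.
apply: (@le_trans _ _ (\sum_(k <oo) g (F k))).
  apply: ereal_inf_lbound; exists F => // x /XA[i _ Aix].
  exists (enum_rank i : nat) => //.
  by rewrite /F insubT// => lti; rewrite (_ : Sub _ _ = enum_rank i) ?enum_rankK//; exact: val_inj.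
rewrite (nneseries_split _ #|I|)// add0n eseries0 ?adde0; last first.
  by move=> k Ik _; rewrite /F insubF// ltnNge Ik.
rewrite big_mkord (eq_bigl (fun i => i \in I))// [leRHS]big_enum_val.
rewrite (eq_bigr (fun i : 'I_#|I| => g (A (enum_val i))))//.
by move=> i _; rewrite /F insubT// => lti; rewrite (_ : Sub _ _ = i)//; exact: val_inj.
Qed.

Lemma hausdorff_gauge_le d (delta e : R) (A : set E) : (0 <= e)%R ->
  (e <= delta)%R -> (forall x y, A x -> A y -> (enorm (x - y) <= e)%R) ->
  hausdorff_gauge d delta A <= (unit_ball_vol d * (e / 2) ^+ d)%:E.
Proof.
move=> e0 ed Ae; have Ade : ediam A <= e%:E.
  by apply: ge_ereal_sup => z [[x y] /= [Ax Ay] <-]; rewrite lee_fin Ae.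
have [->|A0] := eqVneq A set0.
  by rewrite hausdorff_gauge0 lee_fin mulr_ge0 ?unit_ball_vol_ge0 ?exprn_ge0 ?divr_ge0.
rewrite /hausdorff_gauge (negbTE A0) (le_trans Ade) ?lee_fin//.
have /set0P/ediam_ge0 A_ge0 := A0.
apply: ler_wpM2l; first exact: unit_ball_vol_ge0.
apply: lerXn2r; rewrite ?nnegrE ?divr_ge0 ?fine_ge0//.
rewrite ler_pM2r ?invr_gt0// -lee_fin fineK//.
by rewrite ge0_fin_numE// (le_lt_trans Ade) ?ltry.
Qed.

Definition lipschitz_graph (x0 : E) (Q : 'M[R]_n.+1) (gam : 'rV[R]_n -> R) (r : R)
  : set E :=
  [set x | let y := ((x - x0) *m Q)%R in
     y 0%R 0%R = gam (col' 0%R y) /\ forall i, (`|y 0%R i| < r)%R].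

(** Cutting the base cube of side 2r into N^n cubes covers the graph by N^n sets
    of diameter at most C / N, whose gauges add up to a bound independent of N. *)
Lemma lipschitz_graph_finite x0 (Q : 'M[R]_n.+1) gam L r : (0 < r)%R ->
  (Q *m Q^T = 1%:M)%R ->
  (forall y z, (`|gam y - gam z| <= L * enorm (y - z))%R) ->
  surf_outer (lipschitz_graph x0 Q gam r) < +oo.
Proof.
move=> r0 QQ gamL; set S := lipschitz_graph _ _ _ _.
(* A cell whose base has side h = 2r / N has diameter at most (|L| + 1) n h = C / N. *)
pose C := ((`|L| + 1) * (n%:R * (2 * r)))%R.
have C0 : (0 <= C)%R.
  by rewrite mulr_ge0 ?addr_ge0 ?mulr_ge0// ltW.
apply: (@le_lt_trans _ _ (unit_ball_vol n * (C / 2) ^+ n)%:E); last exact: ltry.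
apply: ge_ereal_sup => _ [delta /= delta0 <-].
pose N := (Num.truncn (C / delta)).+1.
have N0 : (0 < N%:R :> R)%R by rewrite ltr0n.
have CN : (C / N%:R <= delta)%R.
  by rewrite ler_pdivrMr// mulrC -ler_pdivrMr//; apply/ltW; exact: truncnS_gt.
pose Y x : E := ((x - x0) *m Q)%R.
pose h : R := (2 * r / N%:R)%R.
have h0 : (0 < h)%R by rewrite divr_gt0 ?mulr_gt0.
pose cell (k : {ffun 'I_n -> 'I_N}) := S `&` [set x | forall i,
  (- r + (k i)%:R * h <= col' 0 (Y x) 0 i <= - r + (k i).+1%:R * h)%R].
have Scell : S `<=` \bigcup_k cell k.
  move=> x Sx; pose z i := ((col' 0 (Y x) 0 i + r) / h)%R.
  have yi i : (`|col' 0 (Y x) 0 i| < r)%R by rewrite mxE; exact: (Sx.2).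
  have z0 i : (0 <= z i)%R.
    by rewrite divr_ge0 ?(ltW h0)//; move: (yi i); rewrite ltr_norml; lra.
  have zN i : (Num.truncn (z i) < N)%N.
    rewrite truncn_lt_nat// /z ltr_pdivrMr// /h mulrCA divff ?gt_eqF// mulr1.
    by move: (yi i); rewrite ltr_norml; lra.
  exists [ffun i => Ordinal (zN i)] => //; split => // i.
  rewrite ffunE /=; have /andP[] := truncn_itv (z0 i).
  move: (Num.truncn _) => t; rewrite /z ler_pdivlMr// ltr_pdivrMr// -natr1; lra.
apply: (le_trans (cover_outer_fin (hausdorff_gauge0 _ _) (hausdorff_gauge_ge0 _ _) Scell)).
have cellb k : hausdorff_gauge n delta (cell k) <=
    (unit_ball_vol n * (C / N%:R / 2) ^+ n)%:E.
  apply: hausdorff_gauge_le => //; first by rewrite divr_ge0.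
  move=> x y [[Sx _] kx] [[Sy _] ky].
  have yxy : (Y x - Y y = (x - y) *m Q)%R.
    by rewrite /Y -mulmxBl; congr (_ *m _)%R; rewrite opprB addrA subrK.
  rewrite -(enorm_mul_orth _ QQ) -yxy.
  have colE : (col' 0 (Y x) - col' 0 (Y y) = col' 0 (Y x - Y y))%R.
    by apply/rowP => i; rewrite !mxE.
  have coord (i : 'I_n) : (`|(Y x - Y y) 0 (lift 0 i)| <= h)%R.
    have := kx i; have := ky i; rewrite !mxE -!natr1 !mulrDl mul1r ler_norml; lra.
  have colh : (\sum_i `|col' 0 (Y x - Y y) 0 i| <= n%:R * h)%R.
    apply: (@le_trans _ _ (\sum_(i < n) h)%R).
      by apply: ler_sum => i _; rewrite mxE coord.
    by rewrite sumr_const card_ord mulr_natl.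
  apply: (le_trans (enorm_le_sum _)); rewrite big_ord_recl.
  have -> : (C / N%:R = `|L| * (n%:R * h) + n%:R * h)%R by rewrite /C /h; field; rewrite gt_eqF.
  apply: lerD; last first.
    apply: le_trans colh; apply: ler_sum => i _; by rewrite [X in (_ <= `|X|)%R]mxE.
  rewrite [X in (`|X| <= _)%R]mxE [X in (`|_ + X| <= _)%R]mxE Sx Sy.
  apply: (le_trans (gamL _ _)); rewrite colE.
  apply: (@le_trans _ _ (`|L| * enorm (col' 0 (Y x - Y y)))%R).
    by apply: ler_wpM2r; rewrite ?enorm_ge0// ler_norm.
  apply: ler_wpM2l => //; apply: le_trans colh; exact: enorm_le_sum.
apply: (le_trans (lee_sum _ (fun k _ => cellb k))).
rewrite sumEFin lee_fin sumr_const card_ffun !card_ord -[X in (X <= _)%R]mulr_natr.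
rewrite natrX -(mulrA (unit_ball_vol n)) -exprMn.
by rewrite (_ : (C / N%:R / 2 * N%:R = C / 2)%R)//; field; rewrite gt_eqF.
Qed.

(** A boundary point does not belong to the open set, so it is not above the graph;
    were it below, the Lipschitz bound would keep a neighbourhood of it below, away
    from the set. *)
Lemma boundary_graph (U : set E) x0 r (Q : 'M[R]_n.+1) gam L : open U ->
  (Q *m Q^T = 1%:M)%R ->
  (forall y z, (`|gam y - gam z| <= L * enorm (y - z))%R) ->
  (forall x, (enorm (x - x0) < r)%R ->
     let y := ((x - x0) *m Q)%R in U x <-> (gam (col' 0 y) < y 0 0)%R) ->
  boundary U `&` [set x | enorm (x - x0) < r]%R `<=` lipschitz_graph x0 Q gam r.
Proof.
move=> oU QQ gamL Ugraph x [[clx nUx] /= xr].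
set y := ((x - x0) *m Q)%R.
split; last first.
  by move=> i; apply: le_lt_trans xr; rewrite -(enorm_mul_orth _ QQ) coord_le_enorm.
have nU : ~ U x by move: nUx; rewrite (interior_id _).1.
rewrite -/y; apply/eqP; rewrite eq_le; apply/andP; split.
  by rewrite leNgt; apply/negP => /(Ugraph x xr).2.
rewrite leNgt; apply/negP => ylt.
pose e := Num.min (r - enorm (x - x0))%R ((gam (col' 0 y) - y 0 0) / (1 + `|L|))%R.
have L1 : (0 < 1 + `|L|)%R by rewrite ltr_pwDl.
have e0 : (0 < e)%R by rewrite lt_min subr_gt0 xr divr_gt0// subr_gt0.
have [z [Uz /= zx]] := clx _ (enorm_ball_nbhs x e0).
have zr : (enorm (z - x0) < r)%R.
  rewrite -(subrK x z) -addrA; apply: (le_lt_trans (enormD _ _)).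
  by rewrite -ltrBrDr (lt_le_trans zx)// ge_min lexx.
have := (Ugraph z zr).1 Uz; apply/negP; rewrite -leNgt.
set w := ((z - x0) *m Q)%R.
have wy : (w - y = (z - x) *m Q)%R.
  by rewrite /w /y -mulmxBl; congr (_ *m _)%R; rewrite opprB addrA subrK.
have wye : (enorm (w - y) < e)%R by rewrite wy enorm_mul_orth.
have w0 : (w 0 0 - y 0 0 <= e)%R.
  have := coord_le_enorm (w - y)%R 0%R; rewrite !mxE => /(le_trans (ler_norm _)) h.
  by rewrite (le_trans _ (ltW wye)).
have wg : (gam (col' 0 y) - gam (col' 0 w) <= `|L| * e)%R.
  apply: (le_trans (ler_norm _)); rewrite distrC; apply: (le_trans (gamL _ _)).
  apply: (@le_trans _ _ (`|L| * enorm (col' 0 w - col' 0 y))%R).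
    by apply: ler_wpM2r; rewrite ?enorm_ge0// ler_norm.
  apply: ler_wpM2l => //; apply: le_trans (ltW wye).
  have -> : (col' 0 w - col' 0 y = col' 0 (w - y))%R.
    by apply/rowP => i; rewrite !mxE.
  exact: enorm_col'.
have : (e * (1 + `|L|) <= gam (col' 0 y) - y 0 0)%R.
  by rewrite -ler_pdivlMr// ge_min lexx orbT.
by rewrite mulrDr mulr1 [(e * _)%R]mulrC; lra.
Qed.

Lemma compact_boundary (U : set E) : bounded_set U -> compact (boundary U).
Proof.
move=> /pinfty_ex_gt0[r /= r0 Ur]; apply: bounded_closed_compact.
  exists r; split; first by rewrite num_real.
  move=> s rs x [clx _] /=; rewrite leNgt; apply/negP => sx.
  have : nbhs x [set y : E | (s < `|y|)%R].
    apply/nbhs_ballP; exists (`|x| - s)%R => /=; first by rewrite subr_gt0.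
    move=> y; rewrite -ball_normE /= => xy.
    by have := ler_dist_dist x y; rewrite ler_norml => /andP[_]; lra.
  by move=> /clx[y [/Ur /= yr sy]]; have := lt_trans rs (lt_le_trans sy yr); rewrite ltxx.
rewrite /boundary setDE; apply: closedI; first exact: closed_closure.
by apply: open_closedC; exact: open_interior.
Qed.

Lemma surf_boundary_finite (U : set E) : lipschitz_domain U ->
  surf_outer (boundary U) < +oo.
Proof.
move=> [oU _ bU _ lipU]; apply: compact_outer_finite; first exact: compact_boundary.
move=> x0 /lipU[r [Q [gam [L [r0 QQ gamL Ugraph]]]]].
exists [set x | enorm (x - x0) < r]%R; first exact: enorm_ball_nbhs.
apply: le_lt_trans (lipschitz_graph_finite x0 r0 QQ gamL).
by apply: le_outer_measure; exact: boundary_graph.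
Qed.

End lipschitz_graph.

(** * Translation invariance *)

Section continuous_measurable.
Context {R : realType} {n : nat}.
Local Notation E := 'rV[R]_n.+1.

Lemma continuous_caratheodory (mu : {outer_measure set E -> \bar R})
    (D : set (caratheodory_type mu)) (f : caratheodory_type mu -> R) :
  halfspaces_measurable mu -> continuous (f : E -> R) -> measurable_fun D f.
Proof.
move=> hmu /continuousP cf mD.
apply: (measurability _ (RGenOInfty.measurableE R)) => //.
move=> _ [_ [a ->] <-]; apply: measurableI => //.
by apply: open_caratheodory => //; apply: cf; exact: interval_open.
Qed.

End continuous_measurable.

Section translation.
Context {R : realType} {n : nat}.
Local Notation E := 'rV[R]_n.+1.
Local Notation CT := (caratheodory_type (@leb_outer R n)).
Local Open Scope ereal_scope.

Definition translate (a : E) (x : CT) : CT := (x + a)%R.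

Lemma box_vol_translate (a : E) A : box_vol (translate a @^-1` A) <= box_vol A.
Proof.
apply: le_ereal_inf_tmp => _ [[p q] /= [pq ->] <-].
have -> : translate a @^-1` box p q = box (p - a)%R (q - a)%R.
  by apply/seteqP; split => x h i; have := h i; rewrite /translate !mxE; lra.
apply: (le_trans (box_vol_le _)) => [i|]; first by rewrite !mxE lerD2r.
rewrite lee_fin le_eqVlt; apply/orP; left; apply/eqP.
by apply: eq_bigr => i _; rewrite !mxE; ring.
Qed.

Let leb_translate_le (a : E) A : leb_outer (translate a @^-1` A) <= leb_outer A.
Proof.
apply: le_ereal_inf_tmp => _ [F AF <-].
apply: (@le_trans _ _ (\sum_(k <oo) box_vol (translate a @^-1` F k))).
  apply: ereal_inf_lbound; exists (fun k => translate a @^-1` F k) => //.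
  by move=> x /AF [k _ Fkx]; exists k.
apply: lee_nneseries => k _; first by move=> _; exact: box_vol_ge0.
exact: box_vol_translate.
Qed.

Lemma translateK (a : E) A : translate a @^-1` (translate (- a)%R @^-1` A) = A.
Proof. by apply/seteqP; split => x; rewrite /= /translate addrK. Qed.

(** Translations permute the boxes and preserve their volumes. *)
Lemma leb_translate (a : E) A : leb_outer (translate a @^-1` A) = leb_outer A.
Proof.
apply/eqP; rewrite eq_le leb_translate_le /=.
rewrite -{1}(translateK (- a)%R A) opprK.
exact: leb_translate_le.
Qed.

Lemma measurable_translate (a : E) : measurable_fun setT (translate a).
Proof.
move=> _ A mA; rewrite setTI.
change (leb_outer.-caratheodory (translate a @^-1` A)) => X.
have shift B : leb_outer (X `&` translate a @^-1` B) =
    leb_outer (translate (- a)%R @^-1` X `&` B).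
  by rewrite -(leb_translate a (_ `&` B)) preimage_setI translateK.
by rewrite preimage_setC !shift -(mA (translate (- a)%R @^-1` X)) leb_translate.
Qed.

Lemma Rintegral_translate (a : E) (f : CT -> R) : measurable_fun setT f ->
  leb.-integrable setT (EFin \o f) ->
  (\int[leb]_x f (translate a x) = \int[leb]_x f x)%R.
Proof.
move=> mf intf; have mT := measurable_translate a.

congr fine.
have pushE A : measurable A -> A `<=` setT -> pushforward leb (translate a) A = leb A.
  by move=> _ _; exact: leb_translate.
transitivity (\int[pushforward leb (translate a)]_y (f y)%:E).
  rewrite integral_pushforward//; first exact/measurable_EFinP.
  apply/integrableP; split.
    by apply/measurable_EFinP; apply: measurableT_comp.
  case/integrableP : intf => _; apply: le_lt_trans.
  rewrite -(@ge0_integral_pushforward _ _ _ _ _ _ mT leb setT (fun y => `|(f y)%:E|))//.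
    rewrite le_eqVlt; apply/orP; left; apply/eqP.
    exact: eq_measure_integral.
  by apply: measurableT_comp => //; exact/measurable_EFinP.
exact: eq_measure_integral.
Qed.

End translation.

(** * Test functions *)

Section test_functions.
Context {R : realType} {n : nat}.
Local Notation E := 'rV[R]_n.+1.
Local Notation CT := (caratheodory_type (@leb_outer R n)).
Local Notation dir i := (delta_mx 0 i : E).

Lemma smooth_continuous (f : E -> R) s : smooth_on setT f -> continuous (partials s f).
Proof. by move=> sf x; have [] := sf s x I. Qed.

Lemma smooth_derivable (f : E -> R) s x i : smooth_on setT f ->
  derivable (partials s f) x (dir i).
Proof. by move=> sf; have [_] := sf s x I. Qed.

Arguments smooth_continuous {f} s.
Arguments smooth_derivable {f} s x i.

Lemma test_fun_partial_support (U : set E) (f : E -> R) i : test_fun U f ->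
  exists K : set E, [/\ compact K, K `<=` U, forall x, ~ K x -> f x = 0 &
    forall x, ~ K x -> partial i f x = 0].
Proof.
move=> [sf [K [cK KU f0]]]; exists K; split => // x nKx.
have cloK : closed K by apply: compact_closed => //; exact: norm_hausdorff.
rewrite /partial (near_eq_derive (g := cst 0)) ?derive_cst//.
have oK : open (~` K) by exact: closed_openC.
by apply: (filterS f0); apply: open_nbhs_nbhs; split.
Qed.

Lemma compact_support_bounded (f : E -> R) (K : set E) : continuous f -> compact K ->
  (forall x, ~ K x -> f x = 0) -> exists2 C, 0 <= C & forall x, `|f x| <= C.
Proof.
move=> cf cK f0.
have /compact_bounded/pinfty_ex_gt0[C /= C0 fC] : compact (f @` K).
  by apply: continuous_compact => //; exact: continuous_subspaceT.
exists C; first exact: ltW.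
move=> x; have [Kx|nKx] := pselect (K x); first by apply: fC; exists x.
by rewrite f0// normr0 ltW.
Qed.

(** Turns a directional derivative into a derivative on the line, to which the mean
    value theorem applies. *)
Lemma is_derive_along (f : E -> R) (x v : E) (s : R) :
  derivable f (s *: v + x) v ->
  is_derive s (1 : R) (fun t => f (t *: v + x)) ('D_v f (s *: v + x)).
Proof.
move=> df.
have eqq : (fun h : R => h^-1 *: (((fun t => f (t *: v + x)) \o shift s) (h *: (1 : R)) -
     f (s *: v + x))) =
   (fun h : R => h^-1 *: ((f \o shift (s *: v + x)) (h *: v) - f (s *: v + x))).
  apply/funext => h /=; congr (_ *: (f _ - _)).
  by rewrite scalerDl addrA /GRing.scale /= mulr1.
by apply: DeriveDef; rewrite /derivable /derive eqq.
Qed.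

Lemma increment_le (f : E -> R) i (C h : R) (x : E) : smooth_on setT f ->
  (forall y, `|partial i f y| <= C) -> 0 <= h ->
  `|f (h *: dir i + x) - f x| <= C * h.
Proof.
move=> sf fC h0.
have dphi s : is_derive s (1 : R) (fun t => f (t *: dir i + x))
    (partial i f (s *: dir i + x)).
  by apply: (@is_derive_along f x (dir i) s); exact: (smooth_derivable [::] _ _ sf).
have [|c _] := MVT_segment h0 (fun s _ => dphi s).
  apply: continuous_subspaceT => s; apply: differentiable_continuous.
  by apply/derivable1_diffP; exact: (@ex_derive _ _ _ _ _ _ _ (dphi s)).
rewrite scale0r add0r subr0 => ->; rewrite normrM (ger0_norm h0).
exact: ler_wpM2r.
Qed.

(** By translation invariance every difference quotient has integral zero. The mean
    value theorem bounds the quotients by the maximum of the derivative, and they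
    vanish outside one bounded set, so the limit passes under the integral. This
    replaces an integration by parts through Fubini's theorem. *)
Lemma test_fun_int_partial_setT (U : set E) (f : E -> R) i : test_fun U f ->
  \int[leb]_(x in (setT : set CT)) partial i f x = 0.
Proof.
move=> tf; have [K [cK KU f0 df0]] := test_fun_partial_support i tf.
have sf := tf.1.
have cf : continuous f := smooth_continuous [::] sf.
have cdf : continuous (partial i f) := smooth_continuous [:: i] sf.
have [C C0 dfC] := compact_support_bounded cdf cK df0.
have [C' C'0 fC'] := compact_support_bounded cf cK f0.
have /compact_bounded/pinfty_ex_gt0[r /= r0 Kr] := cK.
(* The margin 2 leaves room for the translations, of length at most 1. *)
pose B : set CT := [set x : E | `|x| < r + 2].
have mB : measurable B.
  apply: leb_open; rewrite (_ : B = (fun x : E => `|x|) @^-1` `]-oo, (r + 2)[%classic).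
    by apply: open_comp; [move=> x _; exact: norm_continuous|exact: interval_open].
  by apply/seteqP; split => x /=; rewrite in_itv.
have Bfin : (leb B < +oo)%E.
  apply: leb_bounded; exists (r + 2); split; first exact: num_real.
  by move=> M rM x /ltW /= h; rewrite (le_trans h)// ltW.
have KB x h : 0 <= h <= 1 -> K (h *: dir i + x) -> B x.
  move=> /andP[h0 h1] /Kr /= xr; rewrite /B /=.
  have -> : x = (h *: dir i + x) - h *: dir i by rewrite addrAC subrr add0r.
  apply: (le_lt_trans (ler_normB _ _)).
  have : `|h *: dir i| <= 1.
    rewrite normrZ (ger0_norm h0); apply: (@le_trans _ _ (1 * 1)); last by rewrite mulr1.
    apply: ler_pM => //; rewrite [leLHS]mx_normrE.
    by apply: bigmax_le => // j _; rewrite !mxE; case: (_ && _); rewrite ?normr1 ?normr0.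
  lra.
have intB (g : E -> R) D : continuous g -> (forall x, `|g x| <= D) ->
    leb.-integrable B (EFin \o (g : CT -> R)).
  move=> cg gD; apply: measurable_bounded_integrable => //.
    exact/continuous_caratheodory/cg/lebesgue_halfspaces.
  by exists D; split; [exact: num_real|move=> M DM x _ /=; rewrite (le_trans (gD x))// ltW].
have restrictB (g : E -> R) : (forall x, ~ B x -> g x = 0) ->
    \int[leb]_(x in (setT : set CT)) g x = \int[leb]_(x in B) g x.
  move=> g0; rewrite [RHS]Rintegral_mkcond; apply: eq_Rintegral => x _.
  rewrite patchE; case: ifPn => // /negP; rewrite inE; exact: g0.
have fB h : 0 <= h <= 1 -> \int[leb]_(x in B) f (h *: dir i + x) = \int[leb]_(x in B) f x.
  move=> h01; rewrite -restrictB; last by move=> x nBx; apply: f0 => /(KB _ _ h01).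
  rewrite -(@restrictB f); last first.
    by move=> x nBx; apply: f0 => Kx; apply: nBx; apply: (KB x 0); rewrite ?lexx ?ler01// scale0r add0r.
  rewrite -(@Rintegral_translate R n (h *: dir i) f).
  - by apply: eq_Rintegral => x _; rewrite /translate addrC.
  - exact/continuous_caratheodory/cf/lebesgue_halfspaces.
  - rewrite (_ : EFin \o f = (EFin \o f) \_ B).
      by apply/(integrable_mkcond _ mB); exact: intB fC'.
    apply/funext => x; rewrite patchE; case: ifPn => // /negP; rewrite inE => nBx /=.
    rewrite f0// => Kx; apply: nBx; apply: (KB x 0); rewrite ?lexx ?ler01// scale0r add0r//.
rewrite restrictB; last first.
  move=> x nBx; apply: df0 => Kx; apply: nBx.
  by apply: (KB x 0); rewrite ?lexx ?ler01// scale0r add0r.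
pose h k : R := k.+1%:R^-1.
have h0 k : 0 < h k by rewrite invr_gt0.
have h1 k : 0 <= h k <= 1 by rewrite ltW//= invf_le1// ler1n.
pose g k x := (h k)^-1 * (f (h k *: dir i + x) - f x).
have cfh k : continuous (fun x => f (h k *: dir i + x)).
  move=> x; apply: (@continuous_comp _ _ _ (fun x : E => h k *: dir i + x) f); last exact: cf.
  by apply: (@cvgD _ _ _ (nbhs x) _ (fun=> h k *: dir i) id); [exact: cvg_cst|exact: cvg_id].
have cdq k : continuous (fun x => f (h k *: dir i + x) - f x).
  move=> x; apply: (@cvgB _ _ _ (nbhs x) _ (fun x => f (h k *: dir i + x)) f).
    exact: (cfh k x).
  exact: (cf x).
have intg k : \int[leb]_(x in B) g k x = 0.
  rewrite RintegralZl//.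
    rewrite RintegralB//; [|exact: (intB _ C' (cfh k))|exact: intB fC'].
    by rewrite fB// subrr mulr0.
  apply: (intB (fun x => f (h k *: dir i + x) - f x) (C' + C')).
    exact: cdq.
  by move=> x; rewrite (le_trans (ler_normB _ _))// lerD.
have gcvg x : B x -> (g k x)%:E @[k --> \oo] --> (partial i f x)%:E.
  move=> _; apply/fine_cvgP; split; first by near=> k.
  have hcvg : h k @[k --> \oo] --> 0^'.
    move=> A; rewrite /dnbhs /within /= => A0.
    have : \forall k \near \oo, (h k != 0 -> A (h k)) := @cvg_harmonic R _ A0.
    by apply: filterS => k; apply; rewrite gt_eqF.
  have dq : (fun t : R => t^-1 *: ((f \o shift x) (t *: dir i) - f x)) @ 0^' -->
      partial i f x := smooth_derivable [::] x i sf.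
  exact: (cvg_comp _ _ hcvg dq).
have mg k : measurable_fun B (fun x : CT => (g k x)%:E).
  apply/measurable_EFinP; apply/continuous_caratheodory; first exact: lebesgue_halfspaces.
  move=> x; apply: (@cvgM _ _ (nbhs x) _ (fun=> (h k)^-1) (fun x => f (h k *: dir i + x) - f x)).
    exact: cvg_cst.
  exact: (cdq k x).
have intC : leb.-integrable B (cst C%:E).
  by apply: (@intB (cst C) `|C|) => //; exact: cst_continuous.
have gC k x : B x -> (`|(g k x)%:E| <= (cst C%:E : CT -> \bar R) x)%E.
  move=> _; rewrite [leRHS]/= lee_fin /g normrM (gtr0_norm (x := (h k)^-1)) ?invr_gt0//.
  rewrite [leLHS]mulrC ler_pdivrMr//.
  by apply: increment_le; rewrite ?ltW.
have finC x : B x -> (cst C%:E : CT -> \bar R) x \is a fin_num by [].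
have := dominated_cvg mB mg gcvg finC intC gC.
have -> : (fun k => \int[leb]_(x in B) (g k x)%:E)%E = cst 0%E.
  apply/funext => k; rewrite -[LHS]fineK; first by rewrite -[fine _]/(\int[leb]_(x in B) g k x) intg.
  apply: integrable_fin_num => //.
  apply: le_integrable intC => // x Bx; rewrite (le_trans (gC k x Bx))//.
  by rewrite /= ger0_norm.
by move=> dc; rewrite /Rintegral -(cvg_lim _ dc)// lim_cst.
Unshelve. all: by end_near. Qed.
End test_functions.

Arguments smooth_continuous {R n f} s.
Arguments smooth_derivable {R n f} s x i.

(** * Square integrable functions *)

Section square_integrable.
Context {d : measure_display} {T : measurableType d} {R : realType}.
Variables (mu : {measure set T -> \bar R}) (D : set T).
Hypothesis mD : measurable D.
Implicit Types (f g : T -> R).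

Lemma EFin_integrableZl r f : mu.-integrable D (EFin \o f) ->
  mu.-integrable D (EFin \o (fun x => r * f x)).
Proof. by move=> fi; exact: (integrableZl mD r fi). Qed.

Lemma EFin_integrableD f g : mu.-integrable D (EFin \o f) ->
  mu.-integrable D (EFin \o g) -> mu.-integrable D (EFin \o (fun x => f x + g x)).
Proof. by move=> fi gi; exact: (integrableD mD fi gi). Qed.

Lemma sqint_ge0 f : (0 <= sqint mu D f)%E.
Proof. by apply: integral_ge0 => x _; rewrite lee_fin sqr_ge0. Qed.

Lemma in_L2P f : in_L2 mu D f <->
  measurable_fun D f /\ mu.-integrable D (EFin \o (fun x => f x ^+ 2)).
Proof.
have sqr_abs x : `|(f x ^+ 2)%:E|%E = (f x ^+ 2)%:E.
  by rewrite gee0_abs// lee_fin sqr_ge0.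
have intE : (\int[mu]_(x in D) `|(EFin \o (fun x => (f x ^+ 2)%R)) x| = sqint mu D f)%E.
  by apply: eq_integral => x _; exact: sqr_abs.
split=> [[mf fi]|[mf /integrableP[_ fi]]]; split => //.
  apply/integrableP; split.
    by apply/measurable_EFinP; exact: measurable_funX.
  by rewrite intE.
by rewrite -intE.
Qed.

Lemma L2_mul_integrable f g : in_L2 mu D f -> in_L2 mu D g ->
  mu.-integrable D (EFin \o (fun x => f x * g x)).
Proof.
move=> /in_L2P[mf fi] /in_L2P[mg gi].
apply: (le_integrable mD _ _ (integrableD mD fi gi)).
  by apply/measurable_EFinP; exact: measurable_funM.
move=> x _ /=; rewrite lee_fin [leRHS]ger0_norm ?addr_ge0 ?sqr_ge0// ler_norml.
by have := sqr_ge0 (f x + g x); have := sqr_ge0 (f x - g x); nra.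
Qed.

Lemma in_L2_comb a b f g : in_L2 mu D f -> in_L2 mu D g ->
  in_L2 mu D (fun x => a * f x + b * g x).
Proof.
move=> fL gL; apply/in_L2P; split.
  by case: fL gL => mf _ [mg _]; apply: measurable_funD; apply: measurable_funM.
have ff := L2_mul_integrable fL fL.
have fg := L2_mul_integrable fL gL.
have gg := L2_mul_integrable gL gL.
have := integrableD mD (integrableD mD (integrableZl mD (a ^+ 2) ff)
  (integrableZl mD (2 * a * b) fg)) (integrableZl mD (b ^+ 2) gg).
apply: eq_integrable => // x _ /=; rewrite -!EFinM -!EFinD; congr _%:E; ring.
Qed.

Lemma in_L2_bounded f C : (mu D < +oo)%E -> measurable_fun D f ->
  (forall x, D x -> `|f x| <= C) -> in_L2 mu D f.
Proof.
move=> Dfin mf fC; split => //.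
apply: (@le_lt_trans _ _ (\int[mu]_(x in D) (cst (C ^+ 2)%:E x))%E).
  apply: ge0_le_integral => //.
  - by move=> x _; rewrite lee_fin sqr_ge0.
  - by apply/measurable_EFinP; exact: measurable_funX.
  - move=> x Dx; rewrite lee_fin /=; have := fC x Dx.
    by rewrite ler_norml => /andP[? ?]; nra.
rewrite integral_cst//; have D0 := measure_ge0 mu D.
by rewrite -(fineK (x := mu D)) ?ge0_fin_numE// -EFinM ltry.
Qed.

Lemma in_L2_cst c : (mu D < +oo)%E -> in_L2 mu D (fun=> c).
Proof. by move=> Dfin; apply: (@in_L2_bounded _ `|c|). Qed.

Lemma L2_integrable f : (mu D < +oo)%E -> in_L2 mu D f ->
  mu.-integrable D (EFin \o f).
Proof.
move=> Dfin fL; apply: eq_integrable (L2_mul_integrable fL (in_L2_cst 1 Dfin)) => //.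
by move=> x _ /=; rewrite mulr1.
Qed.

(** From (s + t)^2 <= 2 s^2 + 2 t^2; the integrals may be infinite. *)
Lemma sqint_comb_le a b f g : measurable_fun D f -> measurable_fun D g ->
  (sqint mu D (fun x => (a * f x + b * g x)%R) <=
   (2 * a ^+ 2)%:E * sqint mu D f + (2 * b ^+ 2)%:E * sqint mu D g)%E.
Proof.
move=> mf mg; have sq0 (h : T -> R) x : (0 <= (h x ^+ 2)%:E)%E.
  by rewrite lee_fin sqr_ge0.
have msq (h : T -> R) : measurable_fun D h -> measurable_fun D (fun x => (h x ^+ 2)%:E).
  by move=> mh; apply/measurable_EFinP; exact: measurable_funX.
have c0 (c : R) : (0 <= (2 * c ^+ 2)%:E)%E by rewrite lee_fin mulr_ge0// sqr_ge0.
rewrite -!ge0_integralZl//; [|exact: msq..].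
rewrite -ge0_integralD//.
- apply: ge0_le_integral => //.
  + by move=> x _; rewrite lee_fin sqr_ge0.
  + by apply: msq; apply: measurable_funD; apply: measurable_funM.
  + by apply: emeasurable_funD; apply: measurable_funeM; exact: msq.
  + move=> x _; rewrite lee_fin.
    by have := sqr_ge0 (a * f x - b * g x); nra.
- by move=> x _; rewrite mule_ge0.
- by apply: measurable_funeM; exact: msq.
- by move=> x _; rewrite mule_ge0.
- by apply: measurable_funeM; exact: msq.
Qed.

Lemma sqint_comb_cvg a b (f g : (T -> R)^nat) :
  (forall k, measurable_fun D (f k)) -> (forall k, measurable_fun D (g k)) ->
  sqint mu D (f k) @[k --> \oo] --> 0%E ->
  sqint mu D (g k) @[k --> \oo] --> 0%E ->
  sqint mu D (fun x => a * f k x + b * g k x) @[k --> \oo] --> 0%E.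
Proof.
move=> mf mg f0 g0.
apply: (@squeeze_cvge _ _ _ _ (cst 0%E) _ (fun k =>
  (2 * a ^+ 2)%:E * sqint mu D (f k) + (2 * b ^+ 2)%:E * sqint mu D (g k))%E).
- by apply: nearW => k; rewrite sqint_ge0 sqint_comb_le.
- exact: cvg_cst.
- have -> : 0%E = ((2 * a ^+ 2)%:E * 0 + (2 * b ^+ 2)%:E * 0)%E :> \bar R.
    by rewrite !mule0 adde0.
  by apply: cvgeD; [rewrite !mule0|exact: cvgeZl|exact: cvgeZl].
Qed.

Lemma L2_cauchy_schwarz f g : in_L2 mu D f -> in_L2 mu D g ->
  `|\int[mu]_(x in D) (f x * g x)| <= normL2 mu D f * normL2 mu D g.
Proof.
move=> fL gL; have [_ ff] := (in_L2P f).1 fL; have [_ gg] := (in_L2P g).1 gL.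
have fg := L2_mul_integrable fL gL.
apply: discriminant_le; [by apply: Rintegral_ge0 => x _; exact: sqr_ge0..|].
move=> t; rewrite -!RintegralZl//.
rewrite -RintegralD//; last exact: EFin_integrableZl.
rewrite -RintegralD//; last exact: EFin_integrableZl.
  by apply: Rintegral_ge0 => x _; have := sqr_ge0 (f x + t * g x); nra.
by apply: EFin_integrableD => //; exact: EFin_integrableZl.
Qed.

Section vector_fields.
Context {m : nat}.
Implicit Types F G : T -> 'rV[R]_m.

Lemma L2v_dot_integrable F G : in_L2v mu D F -> in_L2v mu D G ->
  mu.-integrable D (EFin \o (fun x => dot (F x) (G x))).
Proof.
move=> FL GL.
have := integrable_sum mD (index_enum 'I_m) (P := xpredT)
  (fun i _ => L2_mul_integrable (FL i) (GL i)).
apply: eq_integrable => // x _ /=.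
by rewrite /dot sumEFin.
Qed.

Lemma in_L2v_comb a b F G : in_L2v mu D F -> in_L2v mu D G ->
  in_L2v mu D (fun x => a *: F x + b *: G x).
Proof.
move=> FL GL i; have := in_L2_comb a b (FL i) (GL i).
by under [in X in _ -> X]eq_fun do rewrite !mxE.
Qed.

Lemma in_L2vB F G : in_L2v mu D F -> in_L2v mu D G ->
  in_L2v mu D (fun x => F x - G x).
Proof.
move=> FL GL; have := in_L2v_comb 1 (-1) FL GL.
by under eq_fun do rewrite scale1r scaleN1r.
Qed.

Lemma normL2vE F : normL2v mu D F = Num.sqrt (\int[mu]_(x in D) dot (F x) (F x)).
Proof. by congr Num.sqrt; apply: eq_Rintegral => x _; rewrite sqr_enorm. Qed.

Lemma sqr_normL2v F : normL2v mu D F ^+ 2 = \int[mu]_(x in D) dot (F x) (F x).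
Proof.
by rewrite normL2vE sqr_sqrtr//; apply: Rintegral_ge0 => x _; exact: dot_ge0.
Qed.

Lemma Rintegral_dot_comb F G t : in_L2v mu D F -> in_L2v mu D G ->
  \int[mu]_(x in D) dot (F x + t *: G x) (F x + t *: G x) =
  \int[mu]_(x in D) dot (F x) (F x) + 2 * t * \int[mu]_(x in D) dot (F x) (G x) +
  t ^+ 2 * \int[mu]_(x in D) dot (G x) (G x).
Proof.
move=> FL GL.
have FF := L2v_dot_integrable FL FL.
have FG := L2v_dot_integrable FL GL.
have GG := L2v_dot_integrable GL GL.
rewrite -!RintegralZl//.
rewrite -RintegralD//; last exact: EFin_integrableZl.
rewrite -RintegralD//; last exact: EFin_integrableZl.
  by apply: eq_Rintegral => x _; exact: dot_comb.
by apply: EFin_integrableD => //; exact: EFin_integrableZl.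
Qed.

Lemma L2v_cauchy_schwarz F G : in_L2v mu D F -> in_L2v mu D G ->
  \int[mu]_(x in D) dot (F x) (G x) <= normL2v mu D F * normL2v mu D G.
Proof.
move=> FL GL; rewrite !normL2vE.
have dd0 H : 0 <= \int[mu]_(x in D) dot (H x) (H x).
  by apply: Rintegral_ge0 => x _; exact: dot_ge0.
apply: le_trans (ler_norm _) _.
by apply: discriminant_le => // t; rewrite -Rintegral_dot_comb.
Qed.

End vector_fields.

End square_integrable.

Section L2_subset.
Context {d : measure_display} {T : measurableType d} {R : realType}.
Variable (mu : {measure set T -> \bar R}).

Lemma sqint_subset (A B : set T) (f : T -> R) : measurable A -> measurable B ->
  A `<=` B -> measurable_fun B f -> (sqint mu A f <= sqint mu B f)%E.
Proof.
move=> mA mB AB mf; apply: ge0_subset_integral => //.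
  by apply/measurable_EFinP; exact: measurable_funX.
by move=> x _; rewrite lee_fin sqr_ge0.
Qed.

Lemma in_L2_subset (A B : set T) (f : T -> R) : measurable A -> measurable B ->
  A `<=` B -> in_L2 mu B f -> in_L2 mu A f.
Proof.
move=> mA mB AB [mf fB]; split; first exact: measurable_funS mf.
by apply: le_lt_trans fB; exact: sqint_subset.
Qed.

End L2_subset.

Section integral_lemmas.
Context {d : measure_display} {T : measurableType d} {R : realType}.
Variables (mu : {measure set T -> \bar R}) (D : set T).
Hypothesis mD : measurable D.

(** The larger function may have an infinite integral. *)
Lemma ae_le_integral_EFin (f g : T -> R) :
  measurable_fun D f -> measurable_fun D g ->
  {ae mu, forall x, D x -> f x <= g x} ->
  (\int[mu]_(x in D) (f x)%:E <= \int[mu]_(x in D) (g x)%:E)%E.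
Proof.
move=> /measurable_EFinP mf /measurable_EFinP mg fg.
rewrite integralE [leRHS]integralE; apply: leeB.
  apply: ae_ge0_le_integral => //; [exact: measurable_funepos..|].
  apply: filterS fg => x fg Dx; rewrite !funeposE.
  by rewrite ge_max le_max le_max lee_fin fg//= lexx orbT.
apply: ae_ge0_le_integral => //; [exact: measurable_funeneg..|].
apply: filterS fg => x fg Dx; rewrite !funenegE.
by rewrite ge_max !le_max leeN2 lee_fin fg//= lexx orbT.
Qed.

(** The coefficients 1 and -1 give the difference the shape of a linear combination
    of Sobolev functions or of traces. *)
Lemma mean_zero_shift (f : T -> R) : (mu D < +oo)%E -> in_L2 mu D f ->
  exists c, \int[mu]_(x in D) (1 * f x + -1 * c) = 0.
Proof.
move=> Dfin fL; have fi := L2_integrable mD Dfin fL.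
have ci c : mu.-integrable D (EFin \o (fun=> c)) by exact: L2_integrable (in_L2_cst mD _ Dfin).
have [D0|D0] := eqVneq (fine (mu D)) 0.
  (* On a null set there is no mean value, but every integral vanishes. *)
  exists 0; have mD0 : mu D = 0%E by rewrite -(fineK (x := mu D)) ?D0// ge0_fin_numE.
  rewrite /Rintegral (null_set_integral mD)//.
  apply/measurable_EFinP/measurable_funD; apply: measurable_funM => //.
  by case: fL.
exists (\int[mu]_(x in D) f x / fine (mu D)).
rewrite RintegralD//; last exact: EFin_integrableZl.
rewrite RintegralZl// Rintegral_cst// mul1r mulN1r mulNr divfK// subrr.
by [].
Qed.

End integral_lemmas.

(** * Operations on Sobolev functions *)

Section test_functions_L2.
Context {R : realType} {n : nat}.
Local Notation E := 'rV[R]_n.+1.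
Local Notation CT := (caratheodory_type (@leb_outer R n)).

Lemma leb_continuous_L2 (U K : set E) (g : E -> R) : open U -> bounded_set U ->
  continuous g -> compact K -> (forall x, ~ K x -> g x = 0) -> in_L2 leb U g.
Proof.
move=> oU bU cg cK g0; have [C _ gC] := compact_support_bounded cg cK g0.
apply: (@in_L2_bounded _ _ _ _ _ (leb_open oU) _ C) => //.
- exact: leb_bounded.
- exact/continuous_caratheodory/cg/lebesgue_halfspaces.
Qed.

Lemma test_fun_L2 (U V : set E) (f : E -> R) : open U -> bounded_set U ->
  test_fun V f -> in_L2 leb U f.
Proof.
move=> oU bU tf; have [_ [K [cK _ f0]]] := tf.
have cf : continuous f := smooth_continuous [::] tf.1.
exact: leb_continuous_L2 oU bU cf cK f0.
Qed.

Lemma test_fun_partial_L2 (U V : set E) (f : E -> R) i : open U -> bounded_set U ->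
  test_fun V f -> in_L2 leb U (partial i f).
Proof.
move=> oU bU tf; have [K [cK _ _ df0]] := test_fun_partial_support i tf.
have cf : continuous (partial i f) := smooth_continuous [:: i] tf.1.
exact: leb_continuous_L2 oU bU cf cK df0.
Qed.

(** Integrals against a test function see only its support, so they do not change
    with the ambient domain. *)
Lemma Rintegral_mul_support (U V K : set E) (w g : E -> R) : K `<=` V -> V `<=` U ->
  (forall x, ~ K x -> g x = 0) ->
  \int[leb]_(x in (U : set CT)) (w x * g x) = \int[leb]_(x in (V : set CT)) (w x * g x).
Proof.
move=> KV VU g0; rewrite Rintegral_mkcond [RHS]Rintegral_mkcond.
apply: eq_Rintegral => x _; rewrite !patchE.
have [Vx|nVx] := pselect (V x); first by rewrite !mem_set//; exact: VU.
have -> : g x = 0 by apply: g0 => /KV.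
by rewrite !mulr0 !if_same.
Qed.

End test_functions_L2.

Section sobolev_operations.
Context {R : realType} {n : nat}.
Local Notation E := 'rV[R]_n.+1.
Local Notation CT := (caratheodory_type (@leb_outer R n)).

Lemma H1_comb (U : set E) (a b : R) (w1 w2 : H1 U) : open U -> bounded_set U ->
  exists w : H1 U, H1_fun w = (fun x => a * w1 x + b * w2 x) /\
                   grad w = (fun x => a *: grad w1 x + b *: grad w2 x).
Proof.
move=> oU bU; have mU := leb_open oU.
have wL : in_L2 leb U (fun x => a * w1 x + b * w2 x).
  by apply: (in_L2_comb mU); exact: H1_L2.
have gL : in_L2v leb U (fun x => a *: grad w1 x + b *: grad w2 x).
  by apply: (in_L2v_comb mU); exact: grad_L2.
have gW : weak_grad U (fun x => a * w1 x + b * w2 x)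
                      (fun x => a *: grad w1 x + b *: grad w2 x).
  move=> f i tf; have fL := test_fun_L2 oU bU tf.
  have dfL := test_fun_partial_L2 i oU bU tf.
  have lin (h1 h2 h : CT -> R) : in_L2 leb U h1 -> in_L2 leb U h2 -> in_L2 leb U h ->
      \int[leb]_(x in U) ((a * h1 x + b * h2 x) * h x) =
      a * \int[leb]_(x in U) (h1 x * h x) + b * \int[leb]_(x in U) (h2 x * h x).
    move=> h1L h2L hL; have i1 := L2_mul_integrable mU h1L hL.
    have i2 := L2_mul_integrable mU h2L hL.
    rewrite -!RintegralZl// -RintegralD//; [|exact: EFin_integrableZl..].
    by apply: eq_Rintegral => x _; ring.
  have rhs : \int[leb]_(x in U) ((a *: grad w1 x + b *: grad w2 x) 0 i * f x) =
      a * \int[leb]_(x in U) (grad w1 x 0 i * f x) +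
      b * \int[leb]_(x in U) (grad w2 x 0 i * f x).
    transitivity (\int[leb]_(x in U)
        ((a * grad w1 x 0 i + b * grad w2 x 0 i) * f x)).
      by apply: eq_Rintegral => x _; rewrite !mxE.
    exact: (lin _ _ _ (grad_L2 w1 i) (grad_L2 w2 i) fL).
  rewrite rhs (lin _ _ _ (H1_L2 w1) (H1_L2 w2) dfL).
  by rewrite !gradP//; ring.
by exists (MkH1 wL gL gW).
Qed.

(** That zero is a weak gradient of a constant says that partial derivatives of
    test functions have zero integral. Subtracting mean values rests on it. *)
Lemma H1_cst (U : set E) (c : R) : open U -> bounded_set U ->
  exists w : H1 U, H1_fun w = (fun=> c) /\ grad w = (fun=> 0).
Proof.
move=> oU bU; have mU := leb_open oU; have Ufin := leb_bounded bU.
have wL : in_L2 leb U (fun=> c) by exact: in_L2_cst.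
have gL : in_L2v leb U (fun=> 0 : E).
  by move=> i; under eq_fun do rewrite mxE; exact: in_L2_cst.
have gW : weak_grad U (fun=> c) (fun=> 0).
  move=> f i tf; have dfL := test_fun_partial_L2 i oU bU tf.
  rewrite (eq_Rintegral _ (g := fun=> 0) (f := fun x : CT => (0 : E) 0 i * f x)); last first.
    by move=> x _; rewrite mxE mul0r.
  rewrite Rintegral_cst// mul0r oppr0.
  have [K [_ KU _ df0]] := test_fun_partial_support i tf.
  have <- := @Rintegral_mul_support _ _ setT U K (fun=> c) _ KU (@subsetT _ _) df0.
  rewrite RintegralZl//; first by rewrite (test_fun_int_partial_setT i tf) mulr0.
  rewrite (_ : EFin \o _ = (EFin \o partial i f) \_ U).
    by apply/(integrable_mkcond _ mU); exact: L2_integrable.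
  apply/funext => x; rewrite patchE; case: ifPn => // /negP; rewrite inE => nUx /=.
  by rewrite df0// => /KU.
by exists (MkH1 wL gL gW).
Qed.

Lemma H1_restrict (U V : set E) (w : H1 U) : open U -> open V -> V `<=` U ->
  exists w' : H1 V, H1_fun w' = H1_fun w /\ grad w' = grad w.
Proof.
move=> oU oV VU; have mU := leb_open oU; have mV := leb_open oV.
have wL : in_L2 leb V w by apply: in_L2_subset (H1_L2 w).
have gL : in_L2v leb V (grad w) by move=> i; apply: in_L2_subset (grad_L2 w i).
have gW : weak_grad V w (grad w).
  move=> f i tf; have [K [cK KV f0 df0]] := test_fun_partial_support i tf.
  have tfU : test_fun U f.
    by split; [exact: tf.1|exists K; split => //; exact: subset_trans VU].
  by have := gradP w i tfU; rewrite !(Rintegral_mul_support _ KV VU).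
by exists (MkH1 wL gL gW).
Qed.

End sobolev_operations.

Section trace_operations.
Context {R : realType} {n : nat}.
Local Notation E := 'rV[R]_n.+1.
Local Notation CT := (caratheodory_type (@leb_outer R n)).
Local Notation ST := (caratheodory_type (@surf_outer R n)).

Lemma partials_comb (a b : R) (f g : E -> R) s :
  smooth_on setT f -> smooth_on setT g ->
  partials s (fun x => a * f x + b * g x) =
  (fun x => a * partials s f x + b * partials s g x).
Proof.
move=> sf sg; elim: s => [//|i s IH]; apply/funext => x /=; rewrite IH.
have df := smooth_derivable s x i sf; have dg := smooth_derivable s x i sg.
rewrite /partial -!/(partials s _).
have dZ c (h : E -> R) : derivable h x (delta_mx 0 i) ->
    'D_(delta_mx 0 i) (c \*: h) x = c * 'D_(delta_mx 0 i) h x.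
  by move=> dh; exact: deriveZ.
rewrite -(dZ a _ df) -(dZ b _ dg).
transitivity ('D_(delta_mx 0 i) ((a \*: partials s f) + (b \*: partials s g)) x).
  by [].
exact: (deriveD (derivableZ (k := a) df) (derivableZ (k := b) dg)).
Qed.

Lemma smooth_comb (a b : R) (f g : E -> R) :
  smooth_on setT f -> smooth_on setT g ->
  smooth_on setT (fun x => a * f x + b * g x).
Proof.
move=> sf sg s x _; rewrite partials_comb//; split.
  apply: (@cvgD _ _ _ (nbhs x) _ (fun x => a * partials s f x)
      (fun x => b * partials s g x)).
    apply: (@cvgM _ _ (nbhs x) _ (fun=> a) (partials s f)); first exact: cvg_cst.
    exact: (smooth_continuous s sf).
  apply: (@cvgM _ _ (nbhs x) _ (fun=> b) (partials s g)); first exact: cvg_cst.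
  exact: (smooth_continuous s sg).
move=> i.
exact: (derivableD (derivableZ (k := a) (smooth_derivable s x i sf))
                   (derivableZ (k := b) (smooth_derivable s x i sg))).
Qed.

Lemma cgrad_comb (a b : R) (f g : E -> R) x :
  smooth_on setT f -> smooth_on setT g ->
  cgrad (fun x => a * f x + b * g x) x = a *: cgrad f x + b *: cgrad g x.
Proof.
move=> sf sg; apply/rowP => i; rewrite !mxE.
exact: (congr1 (fun h => h x) (partials_comb a b [:: i] sf sg)).
Qed.

Lemma smooth_cst (c : R) : smooth_on setT (fun _ : E => c).
Proof.
have pc s : exists c', partials s (fun _ : E => c) = cst c'.
  elim: s => [|i s [c' IH]]; first by exists c.
  by exists 0; apply/funext => x; rewrite /= IH /partial derive_cst.
by move=> s x _; have [c' ->] := pc s; split; [exact: cst_continuous|move=> i; exact: derivable_cst].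
Qed.

Lemma cgrad_cst (c : R) x : cgrad (fun _ : E => c) x = 0.
Proof. by apply/rowP => i; rewrite !mxE /partial derive_cst. Qed.

Lemma measurable_enorm (D : set CT) (F : CT -> E) : measurable D ->
  (forall i, measurable_fun D (fun x => F x 0 i)) ->
  measurable_fun D (fun x => enorm (F x)).
Proof.
move=> mD mF; apply: (measurableT_comp (f := @Num.sqrt R)).
  by apply: continuous_measurable_fun; exact: sqrt_continuous.
by apply: measurable_sum => i; apply: measurable_funM.
Qed.

Lemma measurable_smooth (mu : {outer_measure set E -> \bar R})
    (D : set (caratheodory_type mu)) (f : E -> R) : halfspaces_measurable mu ->
  smooth_on setT f -> measurable_fun D (f : caratheodory_type mu -> R).
Proof.
by move=> hmu sf; apply: continuous_caratheodory => //; exact: (smooth_continuous [::] sf).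
Qed.

Lemma measurable_cgrad_sub (U : set E) (w : H1 U) (f : E -> R) : open U ->
  smooth_on setT f ->
  measurable_fun (U : set CT) (fun x : CT => enorm (cgrad f x - grad w x)).
Proof.
move=> oU sf; apply: measurable_enorm => [|i]; first exact: leb_open.
under eq_fun do rewrite !mxE.
apply: measurable_funB; last by case: (grad_L2 w i).
apply: continuous_caratheodory; first exact: lebesgue_halfspaces.
exact: (smooth_continuous [:: i] sf).
Qed.

(** The approximating smooth functions are combined in the same way. The norm of
    the gradient error is subadditive, so its square integral is controlled by
    that of a combination of two scalar errors. *)
Lemma is_trace_comb (U G : set E) (a b : R) (w w1 w2 : H1 U) (g1 g2 : E -> R) :
  open U -> (caratheodory_display surf_outer).-measurable (G : set ST) ->
  H1_fun w = (fun x => a * w1 x + b * w2 x) ->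
  grad w = (fun x => a *: grad w1 x + b *: grad w2 x) ->
  is_trace G w1 g1 -> is_trace G w2 g2 ->
  is_trace G w (fun x => a * g1 x + b * g2 x).
Proof.
move=> oU mG wE gE [g1L [f1 [sf1 f1w f1g f1t]]] [g2L [f2 [sf2 f2w f2g f2t]]].
have mU := leb_open oU.
split; first exact: in_L2_comb.
exists (fun k x => a * f1 k x + b * f2 k x); split.
- by move=> k; exact: smooth_comb.
- have -> : (fun k => sqint leb U (fun x => a * f1 k x + b * f2 k x - w x)) =
    (fun k => sqint leb U (fun x => a * (f1 k x - w1 x) + b * (f2 k x - w2 x))).
    by apply/funext => k; apply: eq_integral => x _; rewrite wE; congr (_ ^+ 2)%:E; ring.
  have m1 k : measurable_fun (U : set CT) (fun x : CT => f1 k x - w1 x).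
    apply: measurable_funB (H1_L2 w1).1.
    exact: (measurable_smooth (@lebesgue_halfspaces R n) (sf1 k)).
  have m2 k : measurable_fun (U : set CT) (fun x : CT => f2 k x - w2 x).
    apply: measurable_funB (H1_L2 w2).1.
    exact: (measurable_smooth (@lebesgue_halfspaces R n) (sf2 k)).
  exact: (sqint_comb_cvg mU a b m1 m2 f1w f2w).
- pose e1 k (x : CT) := enorm (cgrad (f1 k) x - grad w1 x).
  pose e2 k (x : CT) := enorm (cgrad (f2 k) x - grad w2 x).
  have me1 k : measurable_fun (U : set CT) (e1 k) by exact: measurable_cgrad_sub.
  have me2 k : measurable_fun (U : set CT) (e2 k) by exact: measurable_cgrad_sub.
  have lim0 := sqint_comb_cvg mU `|a| `|b| me1 me2 f1g f2g.
  apply: (@squeeze_cvge _ _ _ _ (cst 0%E) _ _ _ _ _ lim0); last exact: cvg_cst.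
  apply: nearW => k; apply/andP; split; first exact: sqint_ge0.
  apply: ge0_le_integral.
  + exact: mU.
  + by move=> x _; rewrite lee_fin sqr_ge0.
  + apply/measurable_EFinP; apply: measurable_funX.
    by apply: measurable_cgrad_sub => //; exact: smooth_comb.
  + apply/measurable_EFinP; apply: measurable_funX.
    by apply: measurable_funD; apply: measurable_funM.
  + move=> x _; rewrite lee_fin; apply: lerXn2r;
      rewrite ?nnegrE ?enorm_ge0 ?addr_ge0 ?mulr_ge0 ?enorm_ge0//.
    rewrite gE cgrad_comb// (_ : _ - _ = a *: (cgrad (f1 k) x - grad w1 x) +
      b *: (cgrad (f2 k) x - grad w2 x)); last first.
      by rewrite !scalerBr opprD addrACA.
    by apply: (le_trans (enormD _ _)); rewrite !enormZ.
- have -> : (fun k => sqint surf G (fun x => a * f1 k x + b * f2 k x - (a * g1 x + b * g2 x))) =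
    (fun k => sqint surf G (fun x => a * (f1 k x - g1 x) + b * (f2 k x - g2 x))).
    by apply/funext => k; apply: eq_integral => x _; congr (_ ^+ 2)%:E; ring.
  have m1 k : measurable_fun (G : set ST) (fun x : ST => f1 k x - g1 x).
    apply: measurable_funB g1L.1.
    exact: (measurable_smooth (@hausdorff_halfspaces R n n) (sf1 k)).
  have m2 k : measurable_fun (G : set ST) (fun x : ST => f2 k x - g2 x).
    apply: measurable_funB g2L.1.
    exact: (measurable_smooth (@hausdorff_halfspaces R n n) (sf2 k)).
  exact: (sqint_comb_cvg mG a b m1 m2 f1t f2t).
Qed.

Lemma is_trace_cst (U G : set E) (c : R) (w : H1 U) :
  (caratheodory_display surf_outer).-measurable (G : set ST) ->
  (surf_outer G < +oo)%E ->
  H1_fun w = (fun=> c) -> grad w = (fun=> 0) -> is_trace G w (fun=> c).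
Proof.
move=> mG Gfin wE gE; split; first exact: in_L2_cst.
exists (fun _ _ => c); split; first by move=> k; exact: smooth_cst.
- rewrite (_ : (fun _ => _) = cst 0%E); first exact: cvg_cst.
  apply/funext => k; rewrite /sqint integral0_eq// => x _.
  by rewrite wE subrr expr0n.
- rewrite (_ : (fun _ => _) = cst 0%E); first exact: cvg_cst.
  apply/funext => k; rewrite /sqint integral0_eq// => x _.
  by rewrite gE cgrad_cst subrr sqr_enorm /dot big1// => i _; rewrite mxE mul0r.
- rewrite (_ : (fun _ => _) = cst 0%E); first exact: cvg_cst.
  apply/funext => k; rewrite /sqint integral0_eq// => x _.
  by rewrite subrr expr0n.
Qed.

Lemma is_trace_restrict (U V G : set E) (w : H1 U) (w' : H1 V) g :
  open U -> open V -> V `<=` U -> H1_fun w' = H1_fun w -> grad w' = grad w ->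
  is_trace G w g -> is_trace G w' g.
Proof.
move=> oU oV VU wE gE [gL [f [sf fw fg ft]]].
have mU := leb_open oU; have mV := leb_open oV.
split; first exact: gL.
exists f; split; [exact: sf| | |exact: ft].
- apply: (@squeeze_cvge _ _ _ _ (cst 0%E) _ _ _ _ _ fw); last exact: cvg_cst.
  apply: nearW => k; apply/andP; split; first exact: sqint_ge0.
  rewrite wE; apply: sqint_subset mV mU VU _.
  apply: measurable_funB (H1_L2 w).1.
  exact: (measurable_smooth (@lebesgue_halfspaces R n) (sf k)).
- apply: (@squeeze_cvge _ _ _ _ (cst 0%E) _ _ _ _ _ fg); last exact: cvg_cst.
  apply: nearW => k; apply/andP; split; first exact: sqint_ge0.
  rewrite gE; apply: sqint_subset mV mU VU _.
  exact: measurable_cgrad_sub.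
Qed.

End trace_operations.

(** * The interface and the two subdomains *)

Section obstacle_geometry.
Context {R : realType} {n : nat}.
Local Notation E := 'rV[R]_n.+1.
Local Notation ST := (caratheodory_type (@surf_outer R n)).
Variables (M Om Omp Omm : set E).
Hypotheses (hOm : lipschitz_domain Om) (hdiv : divides M Om Omp Omm).

Lemma divides_plus_sub : Omp `<=` Om.
Proof.
move=> x px; have : (Om `\` M) x by rewrite (divides_cover hdiv); left.
by case.
Qed.

Lemma divides_minus_sub : Omm `<=` Om.
Proof.
move=> x px; have : (Om `\` M) x by rewrite (divides_cover hdiv); right.
by case.
Qed.

(** The interface is what remains of the domain when the open subdomains are removed. *)
Lemma measurable_interface :
  (caratheodory_display surf_outer).-measurable (M `&` Om : set ST).
Proof.
have -> : M `&` Om = Om `\` (Omp `|` Omm).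
  by rewrite -(divides_cover hdiv) setDD setIC.
apply: measurableD; first exact: surf_open (domain_open hOm).
apply: measurableU; first exact: surf_open (domain_open (divides_plus hdiv)).
exact: surf_open (domain_open (divides_minus hdiv)).
Qed.

(** Mean values over the interface make sense because it lies in a Lipschitz
    boundary. *)
Lemma interface_finite : (surf_outer (M `&` Om) < +oo)%E.
Proof.
apply: le_lt_trans (surf_boundary_finite (divides_plus hdiv)).
by apply: le_outer_measure => x /(divides_interface hdiv)[].
Qed.

Lemma measurable_boundary (U : set E) :
  (caratheodory_display surf_outer).-measurable (boundary U : set ST).
Proof.
rewrite /boundary -(setCK (closure U)) setDE -setCU; apply: measurableC.
apply: surf_open; apply: openU; last exact: open_interior.
by apply: closed_openC; exact: closed_closure.
Qed.

(** A function that is locally the restriction of a continuous one has relatively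
    open superlevel sets. *)
Lemma measurable_on_hypersurface (psi : E -> R) : smooth_on_hypersurface M psi ->
  measurable_fun (M `&` Om : set ST) (psi : ST -> R).
Proof.
move=> spsi mMO; apply: (measurability _ (RGenOInfty.measurableE R)) => //.
move=> _ [_ [a ->] <-].
pose V := \bigcup_(W in [set W : set E | open W /\ forall x, W x -> M x -> a < psi x]) W.
have -> : (M `&` Om) `&` psi @^-1` `]a, +oo[ = (M `&` Om) `&` V.
  apply/seteqP; split => x [[Mx Omx]] /=; last first.
    by move=> [W [_ Wpsi] Wx]; rewrite in_itv/= andbT; split => //; exact: Wpsi.
  rewrite in_itv/= andbT => apsi; split => //.
  have [U [F [oU Ux sF psiF]]] := spsi x Mx.
  exists (U `&` F @^-1` `]a, +oo[)°; last first.
    apply: filterI; first exact: open_nbhs_nbhs.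
    have [cF _] := sF [::] x Ux; apply: cF.
    apply: open_nbhs_nbhs; split; first exact: interval_open.
    by rewrite /= in_itv/= andbT -psiF.
  split; first exact: open_interior.
  move=> y /interior_subset[Uy /=]; rewrite in_itv/= andbT => aFy My.
  by rewrite psiF.
apply: measurableI => //; apply: surf_open; apply: bigcup_open => W [].
by [].
Qed.

End obstacle_geometry.

(** * Poincare pairings and the variational inequality *)

Section sobolev_estimates.
Context {R : realType} {n : nat}.
Local Notation E := 'rV[R]_n.+1.
Local Notation CT := (caratheodory_type (@leb_outer R n)).
Local Notation ST := (caratheodory_type (@surf_outer R n)).

(** Against a function of zero mean, w may be replaced by w minus its mean. *)
Lemma poincare_pairing (U : set E) (C : R) (w : H1 U) (h : E -> R) :
  open U -> bounded_set U -> poincare_const U C -> in_L2 leb U h ->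
  \int[leb]_(x in U) h x = 0 ->
  `|\int[leb]_(x in U) (h x * w x)| <= C * normL2 leb U h * normL2v leb U (grad w).
Proof.
move=> oU bU hC hL h0; have mU := leb_open oU; have Ufin := leb_bounded bU.
have [c wc0] := mean_zero_shift mU Ufin (H1_L2 w).
have [wc [wcE gcE]] := H1_cst c oU bU.
have [w0 [w0E g0E]] := H1_comb 1 (-1) w wc oU bU.
have hw := L2_mul_integrable mU hL (H1_L2 w).
have hi := L2_integrable mU Ufin hL.
have -> : \int[leb]_(x in U) (h x * w x) = \int[leb]_(x in U) (h x * w0 x).
  rewrite w0E wcE; transitivity (\int[leb]_(x in U) (h x * w x + - c * h x)).
    rewrite RintegralD//; last exact: EFin_integrableZl.
    by rewrite RintegralZl// h0 mulr0 addr0.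
  by apply: eq_Rintegral => x _; ring.
apply: (le_trans (L2_cauchy_schwarz mU hL (H1_L2 w0))).
have -> : grad w = grad w0.
  by rewrite g0E gcE; apply/funext => x; rewrite scaler0 addr0 scale1r.
rewrite mulrAC mulrC; apply: ler_wpM2r; first exact: sqrtr_ge0.
by apply: hC; rewrite w0E wcE.
Qed.

(** As for the volume pairing, with the mean value taken over the interface: the
    constant subtracted changes neither the pairing nor the gradient. *)
Lemma trace_poincare_pairing (U G : set E) (C : R) (w : H1 U) (tw h : E -> R) :
  open U -> bounded_set U ->
  (caratheodory_display surf_outer).-measurable (G : set ST) ->
  (surf_outer G < +oo)%E -> trace_poincare_const G U C -> is_trace G w tw ->
  in_L2 surf G h -> \int[surf]_(x in G) h x = 0 ->
  `|\int[surf]_(x in G) (h x * tw x)| <= C * normL2 surf G h * normL2v leb U (grad w).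
Proof.
move=> oU bU mG Gfin hC htw hL h0.
have [c wc0] := mean_zero_shift mG Gfin htw.1.
have [wc [wcE gcE]] := H1_cst c oU bU.
have [w0 [w0E g0E]] := H1_comb 1 (-1) w wc oU bU.
have tc : is_trace G wc (fun=> c) by exact: is_trace_cst.
have tw0 := is_trace_comb oU mG w0E g0E htw tc.
have hw := L2_mul_integrable mG hL htw.1.
have hi := L2_integrable mG Gfin hL.
have -> : \int[surf]_(x in G) (h x * tw x) =
    \int[surf]_(x in G) (h x * (1 * tw x + -1 * c)).
  transitivity (\int[surf]_(x in G) (h x * tw x + - c * h x)).
    rewrite RintegralD//; last exact: EFin_integrableZl.
    by rewrite RintegralZl// h0 mulr0 addr0.
  by apply: eq_Rintegral => x _; ring.
apply: (le_trans (L2_cauchy_schwarz mG hL tw0.1)).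
have -> : grad w = grad w0.
  by rewrite g0E gcE; apply/funext => x; rewrite scaler0 addr0 scale1r.
rewrite mulrAC mulrC; apply: ler_wpM2r; first exact: sqrtr_ge0.
exact: hC tw0 _.
Qed.

Lemma energyE (U : set E) (w : H1 U) :
  energy w = 2^-1 * \int[leb]_(x in U) dot (grad w x) (grad w x).
Proof.
by rewrite /energy; congr (_ * _); apply: eq_Rintegral => x _; rewrite sqr_enorm.
Qed.

(** The admissible set is convex, so the energy has a nonnegative one-sided
    derivative at its minimizer in the direction of any admissible function. *)
Lemma variational_inequality (M Om : set E) (psi phi : E -> R) (u v : H1 Om) :
  open Om -> bounded_set Om ->
  (caratheodory_display surf_outer).-measurable (M `&` Om : set ST) ->
  is_minimizer (admissible M psi phi) u -> admissible M psi phi v ->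
  0 <= \int[leb]_(x in Om) dot (grad u x) (grad v x - grad u x).
Proof.
move=> oO bO mMO [[[tu tru upsi] bu] umin] [[tv trv vpsi] bv].
have mO := leb_open oO.
set b := \int[leb]_(x in Om) _.
pose c := \int[leb]_(x in Om) dot (grad v x - grad u x) (grad v x - grad u x).
have c0 : 0 <= c by apply: Rintegral_ge0 => x _; exact: dot_ge0.
have gradL := in_L2vB mO (grad_L2 v) (grad_L2 u).
have key t : 0 < t <= 1 -> 0 <= 2 * b + t * c.
  move=> /andP[t0 t1]; have [w [wE gE]] := H1_comb (1 - t) t u v oO bO.
  have wadm : admissible M psi phi w.
    split.
      exists (fun x => (1 - t) * tu x + t * tv x).
        exact: is_trace_comb wE gE tru trv.
      have FF : Filter (almost_everywhere (@surf R n)) by exact: ae_filter_ringOfSetsType.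
      apply: (@filterS2 _ _ FF _ _ _ _ upsi vpsi) => x ux vx Mx.
      by have := ux Mx; have := vx Mx; nra.
    have -> : phi = (fun x => (1 - t) * phi x + t * phi x).
      by apply/funext => x; ring.
    exact: is_trace_comb oO (measurable_boundary _) wE gE bu bv.
  have := umin w wadm; rewrite !energyE ler_pM2l ?invr_gt0//.
  have -> : \int[leb]_(x in Om) dot (grad w x) (grad w x) =
      \int[leb]_(x in Om) dot (grad u x + t *: (grad v x - grad u x))
                             (grad u x + t *: (grad v x - grad u x)).
    apply: eq_Rintegral => x _; rewrite gE.
    have -> // : (1 - t) *: grad u x + t *: grad v x =
                 grad u x + t *: (grad v x - grad u x).
    by rewrite scalerBl scale1r scalerBr addrAC addrA.
  rewrite (Rintegral_dot_comb mO _ (grad_L2 u) gradL) -/b -/c.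
  by move: (\int[leb]_(x in Om) _) => a; nra.
rewrite leNgt; apply/negP => b0.
(* The step t = - b / c, or t = 1 if that exceeds 1, makes 2 b + t c negative. *)
have [cb|bc] := leP c (- b).
  by have := key 1; rewrite ltr01 lexx => /(_ isT); lra.
have c_gt0 : 0 < c by lra.
have := key (- b / c); rewrite divr_gt0 ?oppr_gt0//= ler_pdivrMr// mul1r ltW//.
by rewrite divfK ?gt_eqF// => /(_ isT); lra.
Qed.

End sobolev_estimates.

(** * The error estimate *)

Lemma gradient_subdomains_le (R : realType) (n : nat) (Om Omp Omm : set 'rV[R]_n.+1)
    (F : 'rV[R]_n.+1 -> 'rV[R]_n.+1) :
  open Om -> open Omp -> open Omm -> Omp `&` Omm = set0 -> Omp `<=` Om ->
  Omm `<=` Om -> in_L2v leb Om F ->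
  normL2v leb Omp F ^+ 2 + normL2v leb Omm F ^+ 2 <= normL2v leb Om F ^+ 2.
Proof.
move=> oO oP oN PN0 PO NO FL.
have mO := leb_open oO; have mP := leb_open oP; have mN := leb_open oN.
have mPN := measurableU _ _ mP mN.
have PNO : Omp `|` Omm `<=` Om by move=> x [/PO|/NO].
have FF := L2v_dot_integrable mO FL FL.
have FPN := integrableS mO mPN PNO FF.
rewrite !sqr_normL2v -Rintegral_setU//; last first.
  by rewrite disj_set2E PN0.
apply: fine_le; [exact: integrable_fin_num FPN|exact: integrable_fin_num FF|].
apply: ge0_subset_integral => //; first exact: measurable_int FF.
by move=> x _; rewrite lee_fin dot_ge0.
Qed.

Theorem theorem3p2 (R : realType) (n : nat)
  (M Om Omp Omm : set 'rV[R]_n.+1) (psi phi : 'rV[R]_n.+1 -> R)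
  (hOm : lipschitz_domain Om)
  (hM : smooth_hypersurface M)
  (hdiv : divides M Om Omp Omm)
  (hpsi : smooth_on_hypersurface M psi)
  (hphi : in_Hhalf (boundary Om) phi)
  (hphipsi : forall x, (M `&` boundary Om) x -> psi x <= phi x)
  (CPp CPm CMp CMm : R)
  (hCPp : poincare_const Omp CPp)
  (hCPm : poincare_const Omm CPm)
  (hCMp : trace_poincare_const (M `&` Om) Omp CMp)
  (hCMm : trace_poincare_const (M `&` Om) Omm CMm)
  (u : H1 Om)
  (hu : is_minimizer (admissible M psi phi) u)
  (q : Hdiv M Om Omp Omm) (lam : 'rV[R]_n.+1 -> R)
  (hlam : multiplier M Om lam)
  (hdivp : \int[leb]_(x in Omp) dvg q x = 0)
  (hdivm : \int[leb]_(x in Omm) dvg q x = 0)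
  (hjump : \int[surf]_(x in M `&` Om) (lam x - jump q x) = 0)
  (v : H1 Om) (hv : admissible M psi phi v)
  (tv : 'rV[R]_n.+1 -> R) (htv : is_trace (M `&` Om) v tv)
  (alpha : R) (halpha : 0 <= alpha <= 1) :
  let Dp := CPp * normL2 leb Omp (dvg q) in
  let Dm := CPm * normL2 leb Omm (dvg q) in
  let mp := CMp * normL2 surf (M `&` Om) (fun x => lam x - jump q x) in
  let mm := CMm * normL2 surf (M `&` Om) (fun x => lam x - jump q x) in
  ((normL2v leb Om (fun x => (grad v x - grad u x)%R))%:E <=
     (normL2v leb Om (fun x => (grad v x - q x)%R))%:E
     + (Num.sqrt 2)%:E *
         (\int[surf]_(x in M `&` Om) (lam x * (tv x - psi x))%:E) `^ 2^-1
     + (Num.sqrt ((Dm + alpha * mm) ^+ 2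
                  + (Dp + (1 - alpha) * mp) ^+ 2))%:E)%E.
Proof.
pose ST := caratheodory_type (@surf_outer R n).
cbv zeta; set Dp := CPp * _; set Dm := CPm * _; set mp := CMp * _; set mm := CMm * _.
set A := normL2v leb Om (fun x => (grad v x - q x)%R).
set B := Num.sqrt (_ ^+ 2 + _); set I := (\int[surf]_(x in M `&` Om) _)%E.
have oO := domain_open hOm; have bO := domain_bounded hOm.
have [oP _ bP _ _] := divides_plus hdiv; have [oN _ bN _ _] := divides_minus hdiv.
have mO := leb_open oO.
have PO := divides_plus_sub hdiv; have NO := divides_minus_sub hdiv.
have mG := measurable_interface hOm hdiv; have Gfin := interface_finite hdiv.
have [[tu tru upsi] bu] := hu.1.
have [w [wE gE]] := H1_comb 1 (-1) v u oO bO.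
have gwE x : grad w x = grad v x - grad u x by rewrite gE scale1r scaleN1r.
have trw := is_trace_comb oO mG wE gE htv tru.
set tw := (fun x => 1 * tv x + -1 * tu x) in trw.
have w0 : in_H10 w.
  have := is_trace_comb oO (measurable_boundary _) wE gE hv.2 bu.
  rewrite /in_H10; congr is_trace; apply/funext => x; ring.
set N := normL2v leb Om (fun x => (grad v x - grad u x)%R).
have NE : N = normL2v leb Om (grad w) by congr normL2v; apply/funext => x; rewrite gwE.
have [wp [wpE gpE]] := H1_restrict w oO oP PO.
have [wm [wmE gmE]] := H1_restrict w oO oN NO.
have trp := is_trace_restrict oO oP PO wpE gpE trw.
have trm := is_trace_restrict oO oN NO wmE gmE trw.
pose Np := normL2v leb Omp (grad w); pose Nm := normL2v leb Omm (grad w).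
have NmNp : Nm ^+ 2 + Np ^+ 2 <= N ^+ 2.
  rewrite NE; apply: (gradient_subdomains_le oO oN oP _ NO PO (grad_L2 w)).
  by rewrite setIC; exact: divides_disjoint hdiv.
have hP := poincare_pairing wp oP bP hCPp (dvg_plus_L2 q) hdivp.
have hN := poincare_pairing wm oN bN hCPm (dvg_minus_L2 q) hdivm.
rewrite wpE gpE -/Np -/Dp in hP; rewrite wmE gmE -/Nm -/Dm in hN.
have jL : in_L2 surf (M `&` Om) (fun x => lam x - jump q x).
  have := in_L2_comb mG 1 (-1) hlam.1 (jump_L2 q).
  by congr in_L2; apply/funext => x; ring.
have hMp := trace_poincare_pairing oP bP mG Gfin hCMp trp jL hjump.
have hMm := trace_poincare_pairing oN bN mG Gfin hCMm trm jL hjump.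
rewrite gpE -/Np -/mp in hMp; rewrite gmE -/Nm -/mm in hMm.
have twL := trw.1.
have lamI := L2_mul_integrable mG hlam.1 twL.
have jI := L2_mul_integrable mG jL twL.
(* Only the part of the jump with zero mean can be paired with w minus its mean. *)
have jumpE : \int[surf]_(x in M `&` Om) (jump q x * tw x) =
    \int[surf]_(x in M `&` Om) (lam x * tw x) -
    \int[surf]_(x in M `&` Om) ((lam x - jump q x) * tw x).
  by rewrite -RintegralB//; apply: eq_Rintegral => x _; ring.
have VI := variational_inequality oO bO mG hu hv.
have Asplit : N ^+ 2 = \int[leb]_(x in Om) dot (grad v x - q x) (grad w x) +
    \int[leb]_(x in Om) dot (q x) (grad w x) -
    \int[leb]_(x in Om) dot (grad u x) (grad w x).
  have i1 := L2v_dot_integrable mO (in_L2vB mO (grad_L2 v) (Hdiv_L2 q)) (grad_L2 w).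
  have i2 := L2v_dot_integrable mO (Hdiv_L2 q) (grad_L2 w).
  have i3 := L2v_dot_integrable mO (grad_L2 u) (grad_L2 w).
  rewrite NE sqr_normL2v -RintegralD// -RintegralB//; last exact: EFin_integrableD.
  apply: eq_Rintegral => x _.
  by rewrite -dotDl subrK -dotBl -gwE.
have CS : \int[leb]_(x in Om) dot (grad v x - q x) (grad w x) <= A * N.
  rewrite NE; exact: (L2v_cauchy_schwarz mO (in_L2vB mO (grad_L2 v) (Hdiv_L2 q)) (grad_L2 w)).
have lamE : ((\int[surf]_(x in M `&` Om) (lam x * tw x))%:E <= I)%E.
  rewrite /Rintegral fineK; last exact: integrable_fin_num.
  have ml : measurable_fun (M `&` Om : set ST) (fun x : ST => lam x * tw x).
    by apply: measurable_funM; [exact: hlam.1.1|exact: twL.1].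
  have mr : measurable_fun (M `&` Om : set ST) (fun x : ST => lam x * (tv x - psi x)).
    apply: measurable_funM; first exact: hlam.1.1.
    apply: measurable_funB; first exact: htv.1.1.
    exact: measurable_on_hypersurface hpsi.
  have FF : Filter (almost_everywhere (@surf R n)) by exact: ae_filter_ringOfSetsType.
  have lr : {ae surf, forall x, (M `&` Om) x -> lam x * tw x <= lam x * (tv x - psi x)}.
    apply: (@filterS2 _ _ FF _ _ _ _ hlam.2 upsi) => x lam0 ux Mx.
    apply: ler_wpM2l; first exact: lam0.
    by have := ux Mx; rewrite /tw; lra.
  exact: (ae_le_integral_EFin mG ml mr lr).
have N0 : 0 <= N by exact: sqrtr_ge0.
have A0 : 0 <= A by exact: sqrtr_ge0.
have B0 : 0 <= B by exact: sqrtr_ge0.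
have key : N ^+ 2 <= (A + B) * N + \int[surf]_(x in M `&` Om) (lam x * tw x).
  have := jumpP q w0 trw; rewrite jumpE.
  have BN := pair_cauchy_schwarz (Dm + alpha * mm) (Dp + (1 - alpha) * mp) N0 NmNp.
  rewrite -/B in BN.
  have VI' : 0 <= \int[leb]_(x in Om) dot (grad u x) (grad w x).
    by move: VI; under eq_Rintegral do rewrite -gwE.
  move: Asplit CS hP hN hMp hMm BN VI' halpha; rewrite !ler_norml.
  move: (\int[leb]_(x in Om) dot (grad v x - q x) _) => a1.
  move: (\int[leb]_(x in Om) dot (q x) _) => a2.
  move: (\int[leb]_(x in Om) dot (grad u x) _) => a3.
  move: (\int[leb]_(x in Omp) _) (\int[leb]_(x in Omm) _) => a4 a5.
  move: (\int[surf]_(x in _) (lam x * tw x)) => a6.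
  move: (\int[surf]_(x in _) ((lam x - jump q x) * tw x)) => a7.
  move=> -> CS /andP[hP1 _] /andP[hN1 _] /andP[hMp1 _] /andP[hMm1 _] BN VI' alpha01 jumpq.
  have := convex_bound alpha01 hMm1 hMp1; lra.
(* The integral of lam (v - psi) may be infinite, and so is the right side then. *)
case: I lamE => [r| |] lamE; last by [].
- rewrite poweR_EFin -!EFinM -!EFinD lee_fin; rewrite lee_fin in lamE.
  have NAB : N <= A + B + r `^ 2^-1.
    by apply: quadratic_le; rewrite ?addr_ge0//; apply: (le_trans key); rewrite lerD2l.
  have sqrt2 : 1 <= Num.sqrt 2 :> R by rewrite -[leLHS]sqrtr1 ler_wsqrtr// ler1n.
  have := ler_wpM2r (powR_ge0 r 2^-1) sqrt2; rewrite mul1r; lra.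
- have -> : (+oo%E `^ 2^-1 = +oo :> \bar R)%E by rewrite poweRyr.
  by rewrite gt0_muley ?lte_fin ?sqrtr_gt0// leey.
Qed.
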